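(* Let $d\ge2$ and let $D\subset\mathbb{R}^d$ be a bounded domain with smooth boundary which is discretely simply connected. Let $V:\mathbb{R}\to\mathbb{R}$ be symmetric (even) and twice differentiable with $V''$ Lipschitz, $\inf_{x\in\mathbb{R}}V''(x)>0$, and with the normalization $V''(0)=1$. Let $\beta(\varepsilon)>0$ satisfy $\beta(\varepsilon)+9d\log\varepsilon\to\infty$ as $\varepsilon\to0$. For each $\varepsilon>0$ let $\theta^\varepsilon$ be the zero boundary gradient field on $D^\varepsilon$ with potential $V$ at inverse temperature $\beta(\varepsilon)$, let $\eta^\varepsilon(b)=\theta^\varepsilon(j)-\theta^\varepsilon(i)$ for $b=(i,j)\in(D^\varepsilon)^*$, and let $\tilde\eta^\varepsilon=\sqrt{\beta(\varepsilon)}\,\eta^\varepsilon$. For $\varphi\in C_0^\infty(D)$ set $$\langle\tilde\eta^\varepsilon,\varphi\rangle=\varepsilon^{(d/2)-1}\sum_{b\in(D^\varepsilon)^*}\nabla\varphi(b)\,\tilde\eta^\varepsilon(b),\qquad \nabla\varphi(b)=\varphi(y)-\varphi(x)\ \text{ for } b=(x,y).$$ Then for every $\varphi\in C_0^\infty(D)$ and every $t\in\mathbb{R}$, $$\lim_{\varepsilon\to0}\mathbb{E}\left[e^{it\langle\tilde\eta^\varepsilon,\varphi\rangle}\right]=\exp\left[-\frac{t^2}{2}\int_D\sum_{\alpha=1}^d\left(\frac{\partial\varphi}{\partial x_\alpha}\right)^2dx\right].$$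
   Context: Lattice domain: $D^\varepsilon=D\cap\varepsilon\mathbb{Z}^d$; $\partial D^\varepsilon$ is the set of vertices of $D^\varepsilon$ having a nearest neighbor in $\varepsilon\mathbb{Z}^d\setminus D^\varepsilon$. $(D^\varepsilon)^*$ is the set of directed nearest-neighbor edges $(x,y)$ with $x,y\in D^\varepsilon$. In sums over $(D^\varepsilon)^*$ each nearest-neighbor pair is counted once, with an arbitrary orientation (the summands do not depend on the orientation). Gradient field: the zero boundary gradient field on $D^\varepsilon$ with potential $V$ at inverse temperature $\beta>0$ is the random element $\theta^\varepsilon\in\mathbb{R}^{D^\varepsilon}$ with law $$d\nu_\beta=Z_\beta^{-1}\exp\Big[-\beta\sum_{(i,j)\in(D^\varepsilon)^*}V(\theta^\varepsilon(i)-\theta^\varepsilon(j))\Big]\prod_{i\in D^\varepsilon\setminus\partial D^\varepsilon}d\theta^\varepsilon(i)\prod_{i\in\partial D^\varepsilon}\delta_0(d\theta^\varepsilon(i)),$$ where $Z_\beta$ is the normalizing constant. Discretely simply connected: $(D^\varepsilon)^*$ is called simply connected if for any site self-avoiding loop $b$ in it there is a finite sequence of loops $b_1=b,b_2,\dots,b_N$ in $(D^\varepsilon)^*$ such that $b_j$ and $b_{j-1}$ differ algebraically (i.e. as oriented chains of edges) by a single plaquette (elementary lattice square) for each $j$, and $b_N$ is a trivial loop with no edge. $D$ is discretely simply connected if for each $\varepsilon>0$ such that $(D^\varepsilon)^*$ is nonempty, $(D^\varepsilon)^*$ is simply connected. *)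

(* Defs.v *)
From HB Require Import structures.
From mathcomp Require Import all_boot all_order all_algebra finmap.
From mathcomp Require Import all_classical all_reals all_analysis.
From mathcomp.real_closed Require Import complex.

Set Implicit Arguments.
Unset Strict Implicit.
Unset Printing Implicit Defensive.

Import Order.TTheory GRing.Theory Num.Theory.
Import numFieldNormedType.Exports.

Local Open Scope ring_scope.
Local Open Scope complex_scope.
Local Open Scope classical_set_scope.

(* MathComp-Analysis, over an arbitrary R : realType.  Points of R^d are row
   vectors 'rV[R]_d where topology and derivatives are concerned;
   finite-dimensional measures live on n.-tuple (measurableTypeR R), which
   carries the product sigma-algebra. *)

Section product_of_measures.
Context {R : realType}.

Notation Rm := (measurableTypeR R).
Notation sfmeasure n := {sigma_finite_measure set (n.-tuple Rm) -> \bar R}.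

Section cons.
Context (n : nat) (m1 : {sigma_finite_measure set Rm -> \bar R}).
Context (m2 : sfmeasure n).

Definition tuple_cons (p : Rm * n.-tuple Rm) : n.+1.-tuple Rm :=
  [tuple of p.1 :: p.2].

Definition tuple_uncons (t : n.+1.-tuple Rm) : Rm * n.-tuple Rm :=
  (thead t, [tuple of behead t]).

Lemma measurable_tuple_cons : measurable_fun setT tuple_cons.
Proof. exact: measurable_cons. Qed.

Lemma measurable_tuple_uncons : measurable_fun setT tuple_uncons.
Proof.
apply: measurable_fun_pair; [exact: measurable_tnth|].
exact: measurable_behead.
Qed.

Lemma tuple_consK : cancel tuple_cons tuple_uncons.
Proof. by move=> [x t]; congr pair => //; apply/val_inj. Qed.

Definition cons_measure : set (n.+1.-tuple Rm) -> \bar R :=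
  pushforward (m1 \x m2)%E tuple_cons.

HB.instance Definition _ := Measure.copy cons_measure
  (measure_function_pushforward__canonical__measure_function_Measure
     (m1 \x m2)%E measurable_tuple_cons).

Lemma cons_measure_sigma_finite : sigma_finite setT cons_measure.
Proof.
have /sigma_finiteP[F [TF ndF Foo]] := sigma_finiteT m1.
have /sigma_finiteP[G [TG ndG Goo]] := sigma_finiteT m2.
exists (fun k => tuple_uncons @^-1` (F k `*` G k)).
  rewrite predeqE => t; split=> // _.
  have : setT (tuple_uncons t).1 by []. have : setT (tuple_uncons t).2 by [].
  rewrite TF TG => -[k _ Gk] [n' _ Fn].
  exists (maxn n' k) => //; split.
  - by move: Fn; exact/subsetPset/ndF/leq_maxl.
  - by move: Gk; exact/subsetPset/ndG/leq_maxr.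
move=> k; have [mF Fk] := Foo k; have [mG Gk] := Goo k; split.
  rewrite -[X in measurable X]setTI; apply: measurable_tuple_uncons => //.
  exact: measurableX.
rewrite /cons_measure /pushforward -comp_preimage.
rewrite (_ : tuple_uncons \o tuple_cons = id); last exact/funext/tuple_consK.
by rewrite preimage_id product_measure1E// lte_mul_pinfty// ge0_fin_numE.
Qed.

HB.instance Definition _ := Measure_isSigmaFinite.Build _ _ _ cons_measure
  cons_measure_sigma_finite.

End cons.

Fixpoint product_measure_tuple n :
    ('I_n -> {sigma_finite_measure set Rm -> \bar R}) -> sfmeasure n :=
  match n with
  | 0 => fun _ => \d_[tuple]
  | n'.+1 => fun m =>
      cons_measure (m ord0) (product_measure_tuple (fun i => m (lift ord0 i)))
  end.

Definition lebesgue_measure_tuple n : sfmeasure n :=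
  product_measure_tuple (fun _ : 'I_n => lebesgue_measure).

End product_of_measures.

Section smooth.
Context {R : realType} {d : nat}.
Implicit Types (f : 'rV[R]_d -> R) (D : set 'rV[R]_d).

Definition partial (i : 'I_d) f : 'rV[R]_d -> R :=
  fun x => 'D_(delta_mx 0 i) f x.

Fixpoint Ck (k : nat) f : Prop :=
  continuous f /\
  match k with
  | 0 => True
  | k'.+1 => forall i, (forall x, derivable f x (delta_mx 0 i)) /\
                       Ck k' (partial i f)
  end.

Definition smooth f : Prop := forall k, Ck k f.

Definition test_function D f : Prop :=
  let supp := closure [set x | f x != 0] in
  [/\ smooth f, compact supp & supp `<=` D].

(* Near each boundary point, after relabelling and reorienting the axes, D is
   the set strictly below the graph of a smooth function of the d - 1 other
   coordinates; g is such a function, seen as a function on R^d that does not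
   depend on the i-th coordinate. *)
Definition smooth_boundary D : Prop :=
  forall p, (closure D `\` D°) p ->
  exists (r : R) (i : 'I_d) (s : bool) (g : 'rV[R]_d -> R),
    [/\ 0 < r, smooth g,
        forall x t, g (x + t *: delta_mx 0 i) = g x &
        forall x, ball p r x -> (D x <-> (-1) ^+ s * x 0 i < g x)].

Definition bounded_smooth_domain D : Prop :=
  [/\ D !=set0, open D, connected D, bounded_set D & smooth_boundary D].

End smooth.

(* The site k of Z^d stands for the point eps * k of eps Z^d. *)
Section lattice.
Context {R : realType} {d : nat}.
Implicit Types (D : set 'rV[R]_d) (eps : R) (k l : 'rV[int]_d).

Definition site_point eps k : 'rV[R]_d := \row_i (eps * (k 0 i)%:~R).

Definition nearest_neighbor : rel 'rV[int]_d :=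
  fun k l => \sum_i `|k 0 i - l 0 i| == 1.

Definition lattice_domain D eps : set 'rV[int]_d :=
  [set k | D (site_point eps k)].

Definition lattice_boundary D eps : set 'rV[int]_d :=
  [set k | lattice_domain D eps k /\
           exists2 l, nearest_neighbor k l & ~ lattice_domain D eps l].

Definition lattice_edges D eps : set ('rV[int]_d * 'rV[int]_d) :=
  [set b | [/\ lattice_domain D eps b.1, lattice_domain D eps b.2 &
               nearest_neighbor b.1 b.2]].

(* A loop is given by the cyclic sequence of its sites; its edges join
   consecutive sites, and the last site to the first one.  The trivial loop
   with no edge is [::]. *)
Definition lattice_loop D eps (c : seq 'rV[int]_d) : Prop :=
  cycle nearest_neighbor c /\ (forall k, k \in c -> lattice_domain D eps k).

(* Closed walks x, y, x along a single edge are not counted as self-avoiding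
   loops: they are already zero as chains. *)
Definition self_avoiding (c : seq 'rV[int]_d) : Prop := uniq c /\ (2 < size c)%N.

Definition loop_chain (c : seq 'rV[int]_d) (b : 'rV[int]_d * 'rV[int]_d) : int :=
  let edges := zip c (rot 1 c) in
  (count_mem b edges)%:Z - (count_mem (b.2, b.1) edges)%:Z.

Definition plaquette k (i j : 'I_d) : seq 'rV[int]_d :=
  let ei := delta_mx 0 i in let ej := delta_mx 0 j in
  [:: k; k + ei; k + ei + ej; k + ej].

(* Both orientations of a plaquette are covered, by exchanging i and j. *)
Definition differ_by_plaquette (c c' : seq 'rV[int]_d) : Prop :=
  exists k (i j : 'I_d), i != j /\
    forall b, loop_chain c b - loop_chain c' b = loop_chain (plaquette k i j) b.

Definition simply_connected_edges D eps : Prop :=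
  forall c, lattice_loop D eps c -> self_avoiding c ->
  exists (N : nat) (cs : nat -> seq 'rV[int]_d),
    [/\ cs 0 = c,
        forall n, (n <= N)%N -> lattice_loop D eps (cs n),
        forall n, (n < N)%N -> differ_by_plaquette (cs n) (cs n.+1) &
        cs N = [::]].

Definition discretely_simply_connected D : Prop :=
  forall eps, 0 < eps -> lattice_edges D eps !=set0 ->
    simply_connected_edges D eps.

(* For D bounded and eps > 0 there are finitely many sites; fset_set of an
   infinite set is empty. *)
Definition sites D eps : seq 'rV[int]_d := fset_set (lattice_domain D eps).

(* Each nearest-neighbor pair once, oriented along the positive axes. *)
Definition oriented_edges D eps : seq ('rV[int]_d * 'rV[int]_d) :=
  [seq b <- [seq (k, l) | k <- sites D eps, l <- sites D eps]
    | [exists i, b.2 == b.1 + delta_mx 0 i]].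

End lattice.

Section gradient_field.
Context {R : realType} {d : nat}.
Variables (V : R -> R) (beta : R) (D : set 'rV[R]_d) (eps : R).

(* Configurations: one real per site, in the order of the enumeration sites. *)
Definition config := (size (sites D eps)).-tuple (measurableTypeR R).

Definition height (theta : config) (k : 'rV[int]_d) : R :=
  nth 0 theta (index k (sites D eps)).

Definition site_measure (k : 'rV[int]_d) :
    {sigma_finite_measure set (measurableTypeR R) -> \bar R} :=
  if `[< lattice_boundary D eps k >]
  then (\d_(0 : measurableTypeR R) : sigma_finite_measure _ R)
  else (lebesgue_measure : sigma_finite_measure _ R).

Definition reference_measure :
    {sigma_finite_measure set config -> \bar R} :=
  product_measure_tuple
    (fun i => site_measure (tnth (in_tuple (sites D eps)) i)).

Definition gibbs_weight (theta : config) : R :=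
  expR (- beta * \sum_(b <- oriented_edges D eps)
                    V (height theta b.1 - height theta b.2)).

Definition partition_function : R :=
  \int[reference_measure]_theta gibbs_weight theta.

Definition gradient_field_law (A : set config) : \bar R :=
  ((partition_function^-1)%:E *
   \int[reference_measure]_(theta in A) (gibbs_weight theta)%:E)%E.

Definition eta (theta : config) (b : 'rV[int]_d * 'rV[int]_d) : R :=
  height theta b.2 - height theta b.1.

Definition eta_tilde (theta : config) (b : 'rV[int]_d * 'rV[int]_d) : R :=
  Num.sqrt beta * eta theta b.

Definition pairing (phi : 'rV[R]_d -> R) (theta : config) : R :=
  eps `^ (d%:R / 2 - 1) *
  \sum_(b <- oriented_edges D eps)
     (phi (site_point eps b.2) - phi (site_point eps b.1)) * eta_tilde theta b.

End gradient_field.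

Section complex_expectation.
Context {R : realType}.

Definition expi (x : R) : R[i] := cos x +i* sin x.

Definition complex_expectation dO (Omega : measurableType dO)
    (P : probability Omega R) (Z : Omega -> R[i]) : R[i] :=
  fine 'E_P[fun w => complex.Re (Z w)] +i* fine 'E_P[fun w => complex.Im (Z w)].

End complex_expectation.

Definition dirichlet_energy {R : realType} {d : nat} (D : set 'rV[R]_d)
    (phi : 'rV[R]_d -> R) : R :=
  let pt (x : d.-tuple (measurableTypeR R)) : 'rV[R]_d := \row_i tnth x i in
  \int[lebesgue_measure_tuple d]_(x in pt @^-1` D)
    \sum_(i < d) partial i phi (pt x) ^+ 2.

(* Main.v *)
Require Import Defs.
From HB Require Import structures.
From mathcomp Require Import all_boot all_order all_algebra finmap.
From mathcomp Require Import all_classical all_reals all_analysis.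
From mathcomp.real_closed Require Import complex.
From mathcomp Require Import measurable_realfun ring lra.
Import Order.TTheory GRing.Theory Num.Theory.
Import numFieldNormedType.Exports.
Local Open Scope ring_scope.
Local Open Scope complex_scope.
Local Open Scope classical_set_scope.

(** Put [psi = sqrt beta * theta].  The law of [psi] has density proportional to
    [exp (- sum_b h (A_b))], where [A_b] is the increment of [psi] along the
    edge [b] and [h x = beta * V (x / sqrt beta)].  Since [V''] is Lipschitz and
    [V''(0) = 1], [h'' >= c := inf V''] and [|h'' x - 1| <= l * |x|] with
    [l = L / sqrt beta]: for large [beta] this is a small anharmonic
    perturbation of a lattice Gaussian free field.

    The pairing is [X = sum_b a_b * A_b], where [a_b] is the increment along [b]
    of the rescaled test function [u = eps ^ (d / 2 - 1) * phi], and [u] vanishes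
    on the boundary sites for small [eps].  Translation of the field along [u]
    preserves the reference measure; integrating by parts in that direction gives
    [E (Y * sin (t * X)) = t * sigma2 * E (cos (t * X))], where
    [Y = sum_b a_b * h' (A_b)] and [sigma2 = sum_b a_b ^ 2]
    ([integration_by_parts]).  Write [Y = X + F] with [F = sum_b a_b * r (A_b)]
    and [r x = h' x - x].  The characteristic function
    [chi t = E (cos (t * X))] solves [chi' = - t * sigma2 * chi + E (F * sin (t * X))],
    whence [|chi t - exp (- t ^ 2 * sigma2 / 2)| <= |t| * E |F|] ([cf_error]).

    It remains to see that [E |F|] is small.  Each term of [F] is of order
    [l * a_b], but there are about [eps ^ - d] of them and [a_b] is of order
    [eps ^ (d / 2)], so cancellation is needed.  It comes from the evenness of [V],
    which makes [F] odd, and from the Prekopa-Leindler inequality: strong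
    convexity of [h] lets one compare the weights tilted by [lam * F] and
    [- lam * F], both damped by [exp (- cutoff * S)] with [S = sum_b A_b ^ 2], to
    the weight itself at the midpoint.  As the two tilted integrals are equal by
    symmetry, each is at most 1, so that
    [lam * E |F| <= 1 + cutoff * E S] ([anharmonic_moment]).  Comparing the
    partition function with its image under the dilation by 1/2 bounds [E S] by a
    multiple of the number of sites ([second_moment]).  With
    [lam = sqrt beta] the product [cutoff * E S] stays bounded as [eps] tends to 0,
    so [E |F| = O (1 / sqrt beta)], and [beta] tends to infinity.

    Finally [sigma2] is a Riemann sum for the Dirichlet energy of [phi]
    ([energy_convergence]), and [E (sin (t * X)) = 0] by symmetry. *)

Set Implicit Arguments.
Unset Strict Implicit.
Unset Printing Implicit Defensive.

(** * Brunn-Minkowski inequality on the line *)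

Section lebesgue_line.
Context {R : realType}.
Local Notation mu := (@lebesgue_measure R).
Local Notation Rm := (measurableTypeR R).

Definition affine (a b : R) : Rm -> Rm := fun x => a * x + b.

Lemma measurable_affine (a b : R) : measurable_fun setT (affine a b).
Proof.
by apply: (@measurable_funD _ _ _ _ (fun x => a * x) (cst b)) => //;
  exact: measurable_funM.
Qed.

Lemma lebesgue_measure_affine (a b : R) (A : set Rm) : a != 0 -> measurable A ->
  (`|a|%:E * pushforward mu (affine a b) A = mu A)%E.
Proof.
move=> a0 mA.
pose phi := affine a b.
have mphi : measurable_fun setT phi := measurable_affine a b.
pose pf : {measure set Rm -> \bar R} :=
  measure_function_pushforward__canonical__measure_function_Measure mu mphi.
pose nu : {measure set Rm -> \bar R} := mscale (NngNum (normr_ge0 a)) pf.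
apply/esym; rewrite (lebesgue_measure_unique (mu := nu))//.
move=> _ [[x y] _ <-] /=; rewrite /nu /mscale /= /pushforward.
have [a_gt0|a_lt0|aE] := ltgtP 0 a.
- rewrite [X in mu X = _](_ : _ = `]x, y]%classic)//.
  rewrite (_ : phi @^-1` _ = `](x - b) / a, (y - b) / a]%classic); last first.
    apply/seteqP; split => z /=; rewrite !in_itv/= /phi /affine;
      by rewrite ltr_pdivrMr// ler_pdivlMr// ltrBlDr lerBrDr mulrC.
  rewrite !lebesgue_measure_itv/= !lte_fin ltr_pM2r ?invr_gt0// ltrD2r.
  case: ifP => _; last by rewrite mule0.
  by rewrite -!EFinD -EFinM gtr0_norm//; congr EFin; field.
- rewrite (_ : phi @^-1` _ = `[(y - b) / a, (x - b) / a[%classic); last first.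
    apply/seteqP; split => z /=; rewrite !in_itv/= /phi /affine;
      by rewrite ler_ndivrMr// ltr_ndivlMr// ltrBlDr lerBrDr mulrC andbC.
  rewrite !lebesgue_measure_itv/= !lte_fin ltr_nM2r ?invr_lt0// ltrD2r.
  case: ifP => _; last by rewrite mule0.
  by rewrite -!EFinD -EFinM ltr0_norm//; congr EFin; field.
- by rewrite -aE eqxx in a0.
Qed.

Lemma ge0_integral_affine (a b : R) (f : Rm -> \bar R) : a != 0 ->
  measurable_fun setT f -> (forall x, 0 <= f x)%E ->
  (\int[mu]_x f (a * x + b)%R = (`|a|^-1)%:E * \int[mu]_x f x)%E.
Proof.
move=> a0 mf f0.
pose phi := affine a b.
have mphi : measurable_fun setT phi := measurable_affine a b.
rewrite -[LHS](@ge0_integral_pushforward _ _ _ _ R phi mphi mu setT f)//.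
pose pf : {measure set Rm -> \bar R} :=
  measure_function_pushforward__canonical__measure_function_Measure mu mphi.
pose nu : {measure set Rm -> \bar R} := mscale (NngNum (normr_ge0 a)) pf.
have -> : (\int[mu]_x f x = \int[nu]_x f x)%E.
  by apply: eq_measure_integral => A mA _; exact/esym/lebesgue_measure_affine.
rewrite ge0_integral_mscale// muleA -EFinM mulVf ?mul1e//.
by rewrite normr_eq0.
Qed.

(** For compact [K] and [L] the translates of
    [K] by the least point of [L] and of [L] by the greatest point of [K] meet
    in at most one point, and both lie in [K + L]; inner regularity reduces
    the general case to this one. *)
Lemma brunn_minkowski_line (A B C : set Rm) :
  measurable A -> measurable B -> measurable C -> A !=set0 -> B !=set0 ->
  (forall a b, A a -> B b -> C ((a + b) / 2)) ->
  (mu A + mu B <= 2%:E * mu C)%E.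
Proof.
move=> mA mB mC [a0 Aa0] [b0 Bb0] ABC.
have compact_case (K L : set R) : compact K -> compact L -> K !=set0 ->
    L !=set0 -> K `<=` A -> L `<=` B -> (mu K + mu L <= 2%:E * mu C)%E.
  move=> cK cL K0 L0 KA LB.
  have mK := compact_measurable cK; have mL := compact_measurable cL.
  have idc (D : set R) : {within D, continuous (fun x : R => x)}.
    by apply: continuous_subspaceT => x; exact: cvg_id.
  have [k Kk kmax] := compact_EVT_max K0 cK (idc K).
  have [l Ll lmin] := compact_EVT_min L0 cL (idc L).
  rewrite !inE in Kk Ll.
  pose K1 : set Rm := affine 2 (- l) @^-1` K.
  pose L1 : set Rm := affine 2 (- k) @^-1` L.
  have mpre c (D : set Rm) : measurable D ->
      measurable (affine 2 (- c) @^-1` D).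
    by move=> mD; rewrite -[X in measurable X]setTI; exact: measurable_affine.
  have mK1 : measurable K1 := mpre l K mK.
  have mL1 : measurable L1 := mpre k L mL.
  (* the only possible common point of the two translates *)
  pose p := (k + l) / 2.
  have KLp : K1 `&` (L1 `\ p) = set0.
    apply/seteqP; split => // z [] /= Kz [Lz zp]; apply: zp.
    have := kmax _ (mem_set Kz); have := lmin _ (mem_set Lz).
    by rewrite /p /affine => *; lra.
  have sub : K1 `|` (L1 `\ p) `<=` C.
    move=> z [Kz|[Lz _]].
    - have -> : z = ((2 * z - l) + l) / 2 by field.
      by apply: ABC; [exact: KA|exact: LB].
    - have -> : z = (k + (2 * z - k)) / 2 by field.
      by apply: ABC; [exact: KA|exact: LB].
  have mL1p : measurable (L1 `\ p) by exact: measurableD.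
  have L1E : mu (L1 `\ p) = mu L1.
    apply/eqP; rewrite eq_le; apply/andP; split.
      by apply: le_measure; rewrite ?inE//; exact: subDsetl.
    apply: (@le_trans _ _ (mu ((L1 `\ p) `|` [set p]))).
      apply: le_measure; rewrite ?inE//; first exact: measurableU.
      by move=> z Lz; have [->|/eqP zp] := eqVneq z p; [right|left].
    apply: le_trans (measureU2 _ _ _) _ => //.
    by rewrite [X in (_ + X)%E](lebesgue_measure_set1 p) adde0.
  have scal c (D : set Rm) : measurable D ->
      mu D = (2%:E * mu (affine 2 (- c) @^-1` D))%E.
    move=> mD; rewrite -(@lebesgue_measure_affine 2 (- c) D)//.
    by rewrite ger0_norm.
  rewrite (scal l K)// (scal k L)//= -muleDr//; last by rewrite ge0_adde_def ?inE.
  rewrite lee_pmul2l//.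
  rewrite -/K1 -/L1 -L1E -measureU//.
  by apply: le_measure; rewrite ?inE//; exact: measurableU.
have [Coo|finC] := eqVneq (mu C) +oo%E.
  by rewrite Coo mulry gtr0_sg// mul1e leey.
have fin2C : (2%:E * mu C < +oo)%E by rewrite lte_mul_pinfty ?lee_fin// ltey.
have compact_half (L : set R) : compact L -> L !=set0 -> L `<=` B ->
    (mu A + mu L <= 2%:E * mu C)%E.
  move=> cL L0 LB.
  have finL : (mu L \is a fin_num).
    rewrite ge0_fin_numE//; apply: le_lt_trans fin2C.
    rewrite -[X in (X <= _)%E]add0e -[X in (X + _)%E](lebesgue_measure_set1 a0).
    apply: compact_case => //; [exact: (@compact_set1 R)|by exists a0|].
    by move=> _ ->.
  rewrite -leeBrDr// lebesgue_regularity_inner_sup//.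
  apply: ge_ereal_sup => _ [K [cK KA] <-]; rewrite leeBrDr//.
  have [->|/set0P K0] := eqVneq K set0; last exact: compact_case.
  rewrite measure0 -[X in (X + _)%E](lebesgue_measure_set1 a0).
  apply: compact_case => //; [exact: (@compact_set1 R)|by exists a0|by move=> _ ->].
have leA : (mu A <= 2%:E * mu C)%E.
  have := compact_half _ (@compact_set1 R b0).
  rewrite [X in (_ + X)%E](lebesgue_measure_set1 b0) adde0; apply => //.
    by exists b0.
  by move=> _ ->.
have fA : mu A \is a fin_num by rewrite ge0_fin_numE// (le_lt_trans leA).
rewrite addeC -leeBrDr// lebesgue_regularity_inner_sup//.
apply: ge_ereal_sup => _ [L [cL LB] <-]; rewrite leeBrDr// addeC.
have [->|/set0P L0] := eqVneq L set0; last exact: compact_half.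
by rewrite measure0 adde0.
Qed.

End lebesgue_line.
(** * Prekopa-Leindler inequality on the line *)

Section layer_cake.
Context {R : realType}.
Local Notation mu := (@lebesgue_measure R).
Local Notation Rm := (measurableTypeR R).

Let subgraph (f : Rm -> R) : set (Rm * Rm) := [set p | 0 <= p.2 < f p.1].

Let measurable_subgraph (f : Rm -> R) : measurable_fun setT f ->
  measurable (subgraph f).
Proof.
move=> mf.
have m1 : measurable_fun setT (fun p : Rm * Rm => (0 : R) <= p.2).
  exact: measurable_fun_ler.
have m2 : measurable_fun setT (fun p : Rm * Rm => (p.2 : R) < f p.1).
  by apply: measurable_fun_ltr => //; exact: measurableT_comp.
rewrite (_ : subgraph f = (fun p : Rm * Rm => (0 : R) <= p.2) @^-1` [set true] `&`
    (fun p : Rm * Rm => (p.2 : R) < f p.1) @^-1` [set true]).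
  by apply: measurableI; [have := m1 measurableT [set true]|
    have := m2 measurableT [set true]]; rewrite setTI; exact.
by apply/seteqP; split => p /=; rewrite /subgraph/= => /andP.
Qed.

Definition level (f : Rm -> R) (t : Rm) : \bar R := mu [set x | 0 <= t < f x].

Lemma level_eq0 f t : (forall x, ~~ (0 <= t < f x)) -> level f t = 0%E.
Proof.
move=> ft; rewrite /level (_ : [set x | _] = set0) ?measure0// -subset0 => x/=.
exact/negP.
Qed.

Let level_indic f t : measurable_fun setT f ->
  level f t = (\int[mu]_x (\1_(subgraph f) (x, t))%:E)%E.
Proof.
move=> mf; rewrite (_ : (fun x => _) = (fun x => (\1_(ysection (subgraph f) t) x)%:E)).
  rewrite integral_indic//; last by apply: measurable_ysection; exact: measurable_subgraph.
  rewrite setIT /level; congr mu; apply/seteqP; split => x /=;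
    by rewrite /ysection/= inE.
by apply/funext => x; rewrite !indicE mem_ysection.
Qed.

Lemma measurable_level f : measurable_fun setT f -> measurable_fun setT (level f).
Proof.
move=> mf; rewrite (_ : level f = fun t => mu (ysection (subgraph f) t)).
  by apply: measurable_fun_ysection; exact: measurable_subgraph.
by apply/funext => t; rewrite /level; congr mu; apply/seteqP; split => x /=;
  rewrite /ysection/= inE.
Qed.

Lemma layer_cake (f : Rm -> R) : measurable_fun setT f -> (forall x, 0 <= f x) ->
  (\int[mu]_x (f x)%:E = \int[mu]_t level f t)%E.
Proof.
move=> mf f0.
under [RHS]eq_integral do rewrite level_indic//.
rewrite -(@fubini_tonelli _ _ _ _ _ mu mu (fun p => (\1_(subgraph f) p)%:E))//=; last first.
  by apply/measurable_EFinP/measurable_indic; exact: measurable_subgraph.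
apply: eq_integral => x _.
rewrite (_ : (fun y => _) = (fun y => (\1_(`[0%R, (f x)[%classic : set Rm) y)%:E)).
  rewrite integral_indic// setIT [RHS](lebesgue_measure_itv `[0%R, (f x)[%R)/= lte_fin.
  case: ltP => [_|fx]; first by rewrite sube0.
  by congr EFin; apply/eqP; rewrite eq_le fx f0.
by apply/funext => y; rewrite !indicE; congr ((_%:R)%:E); apply/idP/idP; rewrite !inE/= in_itv.
Qed.

End layer_cake.

(** The hypothesis and conclusion are squared so that no square root of an
    extended real is needed. *)
Definition prekopa_leindler {R : realType} {dT} {T : measurableType dT}
    (mid : T -> T -> T) (m : set T -> \bar R) : Prop :=
  forall f g h : T -> \bar R,
    measurable_fun setT f -> measurable_fun setT g -> measurable_fun setT h ->
    (forall x, 0 <= f x)%E -> (forall x, 0 <= g x)%E -> (forall x, 0 <= h x)%E ->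
    (forall x y, f x * g y <= h (mid x y) * h (mid x y))%E ->
    ((\int[m]_x f x) * (\int[m]_x g x) <= (\int[m]_x h x) * (\int[m]_x h x))%E.

Section prekopa_leindler_line.
Context {R : realType}.
Local Notation mu := (@lebesgue_measure R).
Local Notation Rm := (measurableTypeR R).

Let measurable_level_set (f : Rm -> R) (t : R) : measurable_fun setT f ->
  measurable [set x | 0 <= t < f x].
Proof.
move=> mf; have [t0|t0] := leP 0 t; last first.
  by rewrite (_ : [set _ | _] = set0)// -subset0 => x.
rewrite (_ : [set _ | _] = (fun x => t < f x) @^-1` [set true]).
  by rewrite -[X in measurable X]setTI; exact: (measurable_fun_ltr (f := cst t)).
by apply/seteqP; split => x /=.
Qed.

(** With both suprema equal to 1, the level sets at height [t < 1] are all
    nonempty and satisfy the hypothesis of the Brunn-Minkowski inequality;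
    integrating over [t] gives an additive form of the inequality. *)
Let prekopa_leindler_normalized (f g h : Rm -> R) :
  measurable_fun setT f -> measurable_fun setT g -> measurable_fun setT h ->
  (forall x, 0 <= f x <= 1) -> (forall x, 0 <= g x <= 1) ->
  (forall x, 0 <= h x) ->
  (forall t, t < 1 -> exists x, t < f x) ->
  (forall t, t < 1 -> exists x, t < g x) ->
  (forall x y, f x * g y <= h ((x + y) / 2) ^+ 2) ->
  (\int[mu]_x (f x)%:E + \int[mu]_x (g x)%:E <= 2%:E * \int[mu]_x (h x)%:E)%E.
Proof.
move=> mf mg mh f01 g01 h0 fsup gsup fgh.
have f0 x : 0 <= f x by case/andP: (f01 x).
have g0 x : 0 <= g x by case/andP: (g01 x).
rewrite !layer_cake// -ge0_integralD//; [|exact: measurable_level..].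
rewrite -ge0_integralZl//; [|exact: measurable_level].
apply: ge0_le_integral => //.
- by move=> t _; rewrite adde_ge0.
- by apply: emeasurable_funD; exact: measurable_level.
- by apply: measurable_funeM; exact: measurable_level.
move=> t _.
have [t0|t0] := ltP t 0.
  by rewrite !level_eq0 ?adde0 ?mule0// => x; rewrite leNgt t0.
have [t1|t1] := leP 1 t.
  have lf : level f t = 0%E.
    by apply: level_eq0 => x; rewrite t0/= -leNgt; apply: le_trans t1; case/andP: (f01 x).
  have lg : level g t = 0%E.
    by apply: level_eq0 => x; rewrite t0/= -leNgt; apply: le_trans t1; case/andP: (g01 x).
  by rewrite lf lg adde0 mule_ge0 ?lee_fin.
apply: brunn_minkowski_line => //; do ?exact: measurable_level_set.
- by have [x] := fsup _ t1; exists x => /=; rewrite t0.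
- by have [x] := gsup _ t1; exists x => /=; rewrite t0.
- move=> x y /= /andP[_ tx] /andP[_ ty]; rewrite t0/=.
  rewrite -(@ltr_pXn2r _ 2)// ?nnegrE//; apply: lt_le_trans (fgh x y).
  by rewrite expr2; apply: ltr_pM.
Qed.

(** Dividing [f] and [g] by their suprema [a] and [b], and [h] by [sqrt (a * b)],
    reduces to the normalized case; the additive inequality then gives the
    multiplicative one by the arithmetic-geometric mean inequality. *)
Let prekopa_leindler_bounded (f g : Rm -> R) (h : Rm -> \bar R) (M : R) :
  measurable_fun setT f -> measurable_fun setT g -> measurable_fun setT h ->
  (forall x, 0 <= f x <= M) -> (forall x, 0 <= g x <= M) ->
  (forall x, 0 <= h x)%E ->
  (forall x y, (f x * g y)%:E <= h ((x + y) / 2)%R * h ((x + y) / 2)%R)%E ->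
  ((\int[mu]_x (f x)%:E) * (\int[mu]_x (g x)%:E) <=
   (\int[mu]_x h x) * (\int[mu]_x h x))%E.
Proof.
move=> mf mg mh fM gM h0 fgh.
have f0 x : 0 <= f x by case/andP: (fM x).
have g0 x : 0 <= g x by case/andP: (gM x).
have sup_spec (k : Rm -> R) : (forall x, 0 <= k x <= M) ->
    (forall x, k x <= sup (range k)) /\
    (forall t, t < sup (range k) -> exists x, t < k x).
  move=> kM; split=> [x|t tk].
    apply: ub_le_sup; last by exists x.
    by exists M => _ [y _ <-]; case/andP: (kM y).
  have [||_ [x _ <-]] := @sup_gt _ (range k) t; first by exists (k 0), 0.
    by [].
  by exists x.
have sup0 (k : Rm -> R) : (forall x, 0 <= k x) -> (forall x, k x <= 0) ->
    (\int[mu]_x (k x)%:E = 0)%E.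
  move=> k0 kle; apply: integral0_eq => x _.
  by congr EFin; apply/eqP; rewrite eq_le k0 kle.
have [fsup fgt] := sup_spec f fM; have [gsup ggt] := sup_spec g gM.
set a := sup (range f) in fsup fgt; set b := sup (range g) in gsup ggt.
have [a0|a0] := leP a 0.
  by rewrite (sup0 f)// ?mul0e ?mule_ge0 ?integral_ge0// => x; exact: le_trans a0.
have [b0|b0] := leP b 0.
  by rewrite (sup0 g)// ?mule0 ?mule_ge0 ?integral_ge0// => x; exact: le_trans b0.
pose c := Num.sqrt (a * b).
have c0 : 0 < c by rewrite sqrtr_gt0 mulr_gt0.
have c2 : c ^+ 2 = a * b by rewrite sqr_sqrtr// ltW// mulr_gt0.
(* truncating [h] at [c] keeps it real and does not spoil the hypothesis *)
pose h' x := fine (mine (h x) c%:E) / c.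
have hfin x : mine (h x) c%:E \is a fin_num.
  rewrite ge0_fin_numE; first by rewrite gt_min ltry orbT.
  by rewrite le_min h0 lee_fin ltW.
have h'0 x : 0 <= h' x.
  by rewrite divr_ge0 ?(ltW c0)// fine_ge0// le_min h0 lee_fin ltW.
have mh' : measurable_fun setT h'.
  apply: measurable_funM => //; apply: (measurableT_comp (f := fine)) => //.
  exact: measurable_mine.
have h'h x : ((h' x)%:E <= (c^-1)%:E * h x)%E.
  rewrite /h' EFinM fineK// muleC lee_wpmul2l ?lee_fin ?invr_ge0 ?(ltW c0)//.
  by rewrite ge_min lexx.
have := @prekopa_leindler_normalized (fun x => f x / a) (fun x => g x / b) h'.
have scaleI (k : Rm -> R) (e : R) : 0 < e -> measurable_fun setT k ->
    (forall x, 0 <= k x) ->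
    (\int[mu]_x (k x / e)%:E = (e^-1)%:E * \int[mu]_x (k x)%:E)%E.
  move=> e0 mk k0; rewrite -ge0_integralZl_EFin ?invr_ge0 ?(ltW e0)//.
  - by apply: eq_integral => x _; rewrite mulrC EFinM.
  - by move=> x _; rewrite lee_fin.
  - exact/measurable_EFinP.
have unit01 (k : Rm -> R) e : 0 < e -> (forall x, 0 <= k x) ->
    (forall x, k x <= e) -> forall x, 0 <= k x / e <= 1.
  by move=> e0 k0 ke x; rewrite divr_ge0 ?(ltW e0)//= ler_pdivrMr// mul1r.
have gtdiv (k : Rm -> R) e : 0 < e -> (forall t, t < e -> exists x, t < k x) ->
    forall t, t < 1 -> exists x, t < k x / e.
  move=> e0 ke t t1; have [|x] := ke (t * e); first by rewrite gtr_pMl.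
  by exists x; rewrite ltr_pdivlMr.
rewrite (scaleI f a)// (scaleI g b)//.
move=> /(_ _ _ mh' (unit01 f a a0 f0 fsup) (unit01 g b b0 g0 gsup) h'0
  (gtdiv f a a0 fgt) (gtdiv g b b0 ggt)) PL.
have {}PL : ((a^-1)%:E * \int[mu]_x (f x)%:E + (b^-1)%:E * \int[mu]_x (g x)%:E <=
    (2 * c^-1)%:E * \int[mu]_x h x)%E.
  apply: le_trans (PL _ _ _) _.
  - exact: measurable_funM.
  - exact: measurable_funM.
  - move=> x y; rewrite /h'; have [hc|hc] := leP c%:E (h ((x + y) / 2)).
      rewrite /= divff ?gt_eqF// expr1n.
      by apply: mulr_ile1; rewrite ?divr_ge0 ?ler_pdivrMr ?mul1r ?(ltW a0) ?(ltW b0).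
    have := fgh x y; move: (h0 ((x + y) / 2)) hc.
    case: (h _) => //= r r0 rc; rewrite -EFinM lee_fin => fgr.
    rewrite expr_div_n c2 mulrACA -invfM ler_pM2r ?invr_gt0 ?mulr_gt0//.
  rewrite EFinM -muleA lee_pmul2l//.
  have <- : (\int[mu]_x ((c^-1)%:E * h x) = (c^-1)%:E * \int[mu]_x h x)%E.
    by rewrite ge0_integralZl// lee_fin invr_ge0 ltW.
  apply: ge0_le_integral => //.
  - by move=> x _; rewrite lee_fin.
  - exact/measurable_EFinP.
  - exact: measurable_funeM.
have I0 (k : Rm -> R) : (forall x, 0 <= k x) -> (0 <= \int[mu]_x (k x)%:E)%E.
  by move=> k0; apply: integral_ge0 => x _; rewrite lee_fin.
have H0 : (0 <= \int[mu]_x h x)%E by exact: integral_ge0.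
move: PL (I0 f f0) (I0 g g0) H0.
move: (\int[mu]_x h x)%E (\int[mu]_x (f x)%:E)%E (\int[mu]_x (g x)%:E)%E.
have ai : 0 < a^-1 by rewrite invr_gt0.
have bi : 0 < b^-1 by rewrite invr_gt0.
move=> [H| |] F G //; last by move=> _ _ _ _; rewrite mulyy leey.
move=> PL F0 G0; rewrite lee_fin => H0.
have FG0 : (0 <= (a^-1)%:E * F)%E /\ (0 <= (b^-1)%:E * G)%E.
  by rewrite !mule_ge0// lee_fin ltW.
have [Ffin Gfin] : F \is a fin_num /\ G \is a fin_num.
  move: PL F0 G0 FG0; rewrite -EFinM.
  case: F => [F| |]; case: G => [G| |] //; do ?[by rewrite leye_eq];
    by rewrite ?gt0_muley ?lte_fin// ?addye ?addey ?leye_eq.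
move: F G Ffin Gfin PL F0 G0 {FG0} => [F| |] // [G| |] // _ _.
rewrite -!EFinM !lee_fin => PL F0 G0.
have AM : F / a * (G / b) <= (H / c) ^+ 2.
  rewrite -(@ler_pM2l _ 4)//; apply: (@le_trans _ _ ((F / a + G / b) ^+ 2)).
    rewrite -subr_ge0 (_ : _ - _ = (F / a - G / b) ^+ 2) ?sqr_ge0//.
    by field; rewrite !gt_eqF.
  have -> : 4 * (H / c) ^+ 2 = (2 / c * H) ^+ 2 by field; rewrite gt_eqF.
  rewrite ler_pXn2r// ?nnegrE; first by rewrite [F / a]mulrC [G / b]mulrC.
    by rewrite addr_ge0// divr_ge0// ltW.
  by rewrite mulr_ge0// divr_ge0// ltW.
move: AM; rewrite expr_div_n c2 mulrACA -invfM.
by rewrite ler_pM2r ?invr_gt0 ?mulr_gt0.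
Qed.

Import HBNNSimple.

(** Simple functions increasing to [f] and [g] are bounded and satisfy the
    hypothesis with the same [h]. *)
Lemma prekopa_leindler_lebesgue :
  prekopa_leindler (fun x y : Rm => (x + y) / 2 : Rm) mu.
Proof.
move=> f g h mf mg mh f0 g0 h0 fgh.
have HH : (0 <= (\int[mu]_x h x) * (\int[mu]_x h x))%E.
  by rewrite mule_ge0// integral_ge0.
have [->|F0] := eqVneq (\int[mu]_x f x)%E 0%E; first by rewrite mul0e.
have [->|G0] := eqVneq (\int[mu]_x g x)%E 0%E; first by rewrite mule0.
have approx (k : Rm -> \bar R) (mk : measurable_fun setT k) :
    (forall x, 0 <= k x)%E ->
    let k_ := nnsfun_approx measurableT mk in
    ((\int[mu]_x (k_ n x)%:E)%E @[n --> \oo] --> (\int[mu]_x k x)%E) /\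
    (forall n x, ((k_ n x)%:E <= k x)%E).
  move=> k0 k_.
  have cvgk x : (k_ n x)%:E @[n --> \oo] --> k x.
    exact: cvg_nnsfun_approx.
  have ndk x : {homo (fun n => (k_ n x)%:E) : n m / (n <= m)%N >-> (n <= m)%E}.
    by move=> n m nm; rewrite lee_fin; exact/lefP/nd_nnsfun_approx.
  split=> [|n x].
    have -> : (\int[mu]_x k x = \int[mu]_x limn (fun n => (k_ n x)%:E))%E.
      by apply: eq_integral => x _; apply/esym/cvg_lim.
    apply: cvg_monotone_convergence => //.
    - by move=> n; exact/measurable_EFinP.
    - by move=> n x _; rewrite lee_fin.
  have /cvg_lim <- // := cvgk x.
  have /cvg_lim -> // := ereal_nondecreasing_cvgn (ndk x).
  by apply: ereal_sup_ubound; exists n.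
have [cvgf lef] := approx f mf f0; have [cvgg leg] := approx g mg g0.
set f_ := nnsfun_approx _ mf in cvgf lef; set g_ := nnsfun_approx _ mg in cvgg leg.
have cvgfg : ((\int[mu]_x (f_ n x)%:E) * (\int[mu]_x (g_ n x)%:E))%E @[n --> \oo]
    --> ((\int[mu]_x f x) * (\int[mu]_x g x))%E.
  by apply: cvgeM => //; apply: neq0_mule_def; rewrite mule_neq0.
have /cvg_lim <- // := cvgfg.
apply: lime_le; first by apply/cvg_ex; eexists; exact: cvgfg.
apply: nearW => n.
have [M fM] : exists M, forall x, f_ n x <= M /\ g_ n x <= M.
  have [M1 h1] := bounded_fun_has_ubound (simple_bounded (f_ n)).
  have [M2 h2] := bounded_fun_has_ubound (simple_bounded (g_ n)).
  exists (Num.max M1 M2) => x; rewrite !le_max.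
  by rewrite h1/= ?h2 ?orbT//; exists x.
apply: (@prekopa_leindler_bounded _ _ _ M) => //.
- by move=> x; rewrite (fM x).1 andbT.
- by move=> x; rewrite (fM x).2 andbT.
- move=> x y; apply: le_trans (fgh x y); rewrite EFinM.
  by apply: lee_pmul; rewrite ?lee_fin ?lef ?leg.
Qed.

End prekopa_leindler_line.
(** * Products of measures on the line *)

Section product_of_lines.
Context {R : realType}.
Local Notation mu := (@lebesgue_measure R).
Local Notation Rm := (measurableTypeR R).
Local Notation sfm T := {sigma_finite_measure set T -> \bar R}.

Definition midpoint (x y : Rm) : Rm := (x + y) / 2.

Definition tuple_midpoint n (x y : n.-tuple Rm) : n.-tuple Rm :=
  [tuple midpoint (tnth x i) (tnth y i) | i < n].

Definition tuple_affine n (a : R) (u : 'I_n -> R) (x : n.-tuple Rm) : n.-tuple Rm :=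
  [tuple affine a (u i) (tnth x i) | i < n].

Lemma tuple_midpoint_cons n x y (s t : n.-tuple Rm) :
  tuple_midpoint (tuple_cons (x, s)) (tuple_cons (y, t)) =
  tuple_cons (midpoint x y, tuple_midpoint s t).
Proof.
apply: eq_from_tnth => i; rewrite tnth_mktuple.
by case: (unliftP ord0 i) => [j|] ->; rewrite ?tnthS ?tnth0 ?tnth_mktuple.
Qed.

Lemma tuple_affine_cons n a (u : 'I_n.+1 -> R) x (t : n.-tuple Rm) :
  tuple_affine a u (tuple_cons (x, t)) =
  tuple_cons (affine a (u ord0) x, tuple_affine a (u \o lift ord0) t).
Proof.
apply: eq_from_tnth => i; rewrite tnth_mktuple.
by case: (unliftP ord0 i) => [j|] ->; rewrite ?tnthS ?tnth0 ?tnth_mktuple.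
Qed.

Lemma measurable_tuple_affine n a (u : 'I_n -> R) :
  measurable_fun setT (tuple_affine a u).
Proof.
apply/measurable_fun_tnthP => i.
rewrite (_ : _ \o _ = affine a (u i) \o (fun x : n.-tuple Rm => tnth x i)).
  by apply: measurableT_comp; [exact: measurable_affine|exact: measurable_tnth].
by apply/funext => x /=; rewrite tnth_mktuple.
Qed.

Section cons_integral.
Context (n : nat) (m1 : sfm Rm) (m2 : sfm (n.-tuple Rm)).
Variable f : n.+1.-tuple Rm -> \bar R.
Hypotheses (mf : measurable_fun setT f) (f0 : forall x, (0 <= f x)%E).

Let mfc : measurable_fun setT (f \o @tuple_cons R n).
Proof. by apply: measurableT_comp => //; exact: measurable_tuple_cons. Qed.

Lemma ge0_integral_cons :
  (\int[cons_measure m1 m2]_x f x =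
   \int[m1]_x \int[m2]_t f (tuple_cons (x, t)))%E.
Proof.
rewrite [LHS](@ge0_integral_pushforward _ _ _ _ R _ (@measurable_tuple_cons R n)
  (m1 \x m2)%E setT f)// preimage_setT.
by rewrite fubini_tonelli1//= => x; exact: f0.
Qed.

Lemma measurable_cons_marginal :
  measurable_fun setT (fun x => \int[m2]_t f (tuple_cons (x, t)))%E.
Proof.
apply: (@measurable_fun_fubini_tonelli_F _ _ _ _ R m2 (f \o @tuple_cons R n)) => // x.
exact: f0.
Qed.

Lemma measurable_cons_section x :
  measurable_fun setT (fun t => f (tuple_cons (x, t))).
Proof.
by apply: (measurableT_comp mfc); exact: measurable_pair1.
Qed.

End cons_integral.

(** The induction step integrates out the first coordinate: its marginals
    satisfy the one-dimensional hypothesis by the inequality for the others. *)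
Lemma prekopa_leindler_product n (m : 'I_n -> sfm Rm) :
  (forall i, prekopa_leindler midpoint (m i)) ->
  prekopa_leindler (@tuple_midpoint n) (product_measure_tuple m).
Proof.
elim: n m => [m _|n IH m PLm] f g h mf mg mh f0 g0 h0 fgh.
  rewrite /= !integral_dirac// !diracT !mul1e.
  by apply: le_trans (fgh _ _) _; rewrite (tuple0 (tuple_midpoint _ _)).
rewrite !ge0_integral_cons//.
pose marg k x :=
  (\int[product_measure_tuple (fun i => m (lift ord0 i))]_t k (tuple_cons (x, t)))%E.
refine (PLm ord0 (marg f) (marg g) (marg h) _ _ _ _ _ _ _);
  do ?exact: measurable_cons_marginal;
  do ?[by move=> x; apply: integral_ge0].
move=> x y; refine (IH (fun i => m (lift ord0 i)) (fun i => PLm (lift ord0 i))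
  (fun t => f (tuple_cons (x, t)))
  (fun t => g (tuple_cons (y, t))) (fun t => h (tuple_cons (midpoint x y, t))) _ _ _ _ _ _ _);
  do ?exact: measurable_cons_section; do ?by [].
by move=> s t; rewrite -tuple_midpoint_cons; exact: fgh.
Qed.

(** Quasi-invariance of a product measure, one coordinate at a time.  An
    inequality with [k = 1] is enough to express the invariance under an
    invertible map: the inverse map gives the converse inequality. *)
Lemma affine_bound_product n (m : 'I_n -> sfm Rm) (a : R) (u : 'I_n -> R) (k : R) :
  0 <= k ->
  (forall i (f : Rm -> \bar R), measurable_fun setT f -> (forall x, 0 <= f x)%E ->
     (\int[m i]_x f (affine a (u i) x) <= k%:E * \int[m i]_x f x)%E) ->
  forall f : n.-tuple Rm -> \bar R,
    measurable_fun setT f -> (forall x, 0 <= f x)%E ->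
    (\int[product_measure_tuple m]_x f (tuple_affine a u x) <=
     (k ^+ n)%:E * \int[product_measure_tuple m]_x f x)%E.
Proof.
move=> k0; elim: n m u => [m u _|n IH m u bound] f mf f0.
  have mf0 : measurable_fun setT (fun x => f (tuple_affine a u x)).
    by apply: measurableT_comp mf _; exact: measurable_tuple_affine.
  by rewrite /= !integral_dirac// !diracT !mul1e (tuple0 (tuple_affine _ _ _)).
have mfa : measurable_fun setT (fun x => f (tuple_affine a u x)).
  by apply: measurableT_comp mf _; exact: measurable_tuple_affine.
rewrite [leLHS]ge0_integral_cons// [in leRHS]ge0_integral_cons//.
pose F x := (\int[product_measure_tuple (fun i => m (lift ord0 i))]_t
  f (tuple_cons (x, t)))%E.
have F0 x : (0 <= F x)%E by exact: integral_ge0.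
have mF : measurable_fun setT F by exact: measurable_cons_marginal.
have mFa : measurable_fun setT (fun x => F (affine a (u ord0) x)).
  by apply: measurableT_comp mF _; exact: measurable_affine.
apply: (@le_trans _ _ (\int[m ord0]_x ((k ^+ n)%:E * F (affine a (u ord0) x)))%E).
  apply: ge0_le_integral => //.
  - by move=> x _; apply: integral_ge0.
  - exact: (measurable_cons_marginal _ mfa).
  - exact: measurable_funeM.
  move=> x _; under eq_integral do rewrite tuple_affine_cons.
  apply: (IH (fun i => m (lift ord0 i)) (u \o lift ord0) _
    (fun t => f (tuple_cons (affine a (u ord0) x, t)))) => //.
  - by move=> i g mg g0; exact: bound.
  - exact: measurable_cons_section.
rewrite ge0_integralZl//; last by rewrite lee_fin exprn_ge0.
rewrite exprSr EFinM -muleA lee_wpmul2l ?lee_fin ?exprn_ge0//.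
exact: (bound ord0).
Qed.

Lemma prekopa_leindler_dirac0 :
  prekopa_leindler midpoint (\d_(0 : Rm) : sfm Rm).
Proof.
move=> f g h mf mg mh f0 g0 h0 fgh.
rewrite !integral_dirac// !diracT !mul1e; apply: le_trans (fgh _ _) _.
by rewrite /midpoint add0r mul0r.
Qed.

End product_of_lines.
(** * Strongly convex even potentials *)

Section strongly_convex_potential.
Context {R : realType}.

Lemma mean_value (f f' : R -> R) (x y : R) :
  (forall z : R, is_derive z 1 f (f' z)) ->
  exists z, [/\ Num.min x y <= z, z <= Num.max x y & f y - f x = f' z * (y - x)].
Proof.
move=> df.
wlog xy : x y / x <= y.
  move=> H; case/orP: (le_total x y) => [/H//|/H[z [z1 z2 fz]]]; exists z.
  by rewrite minC maxC; split=> //; rewrite -opprB fz -mulrN opprB.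
have cf : {within `[x, y], continuous f}.
  apply: continuous_subspaceT => z.
  by apply: differentiable_continuous; apply/derivable1_diffP; case: (df z).
have [z] := MVT_segment xy (fun z _ => df z) cf.
rewrite in_itv/= => /andP[xz zy] fz; exists z.
by rewrite (min_idPl xy) (max_idPr xy).
Qed.

Variables (h h1 h2 : R -> R) (c l : R).
Hypotheses (dh : forall x : R, is_derive x 1 h (h1 x))
           (dh1 : forall x : R, is_derive x 1 h1 (h2 x)).
Hypotheses (c0 : 0 < c) (h2c : forall x, c <= h2 x).
Hypotheses (l0 : 0 <= l) (h2l : forall x, `|h2 x - 1| <= l * `|x|).
Hypothesis h_even : forall x, h (- x) = h x.

Lemma derive_even_odd x : h1 (- x) = - h1 x.
Proof.
have d : is_derive x 1 (h \o -%R) (- h1 (- x)).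
  have -> : - h1 (- x) = h1 (- x) * -1 by rewrite mulrN1.
  by apply: is_derive1_comp; exact: is_deriveNid.
rewrite (_ : h \o -%R = h) in d; last by apply/funext => y; exact: h_even.
rewrite -[LHS]opprK; congr (- _).
by rewrite -(@derive_val _ _ _ _ _ _ _ d) (@derive_val _ _ _ _ _ _ _ (dh x)).
Qed.

Lemma derive_even0 : h1 0 = 0.
Proof. by have := derive_even_odd 0; rewrite oppr0 => ?; lra. Qed.

Lemma derive_strongly_monotone x y : c * (x - y) ^+ 2 <= (h1 x - h1 y) * (x - y).
Proof.
have [z [_ _ ->]] := mean_value y x dh1.
by rewrite -mulrA -expr2 ler_wpM2r// sqr_ge0.
Qed.

(** [h x - c / 2 * x ^ 2] is convex, hence above its tangents. *)
Lemma strong_tangent x y :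
  h x + h1 x * (y - x) + c / 2 * (y - x) ^+ 2 <= h y.
Proof.
pose k z := h z - c / 2 * z ^+ 2; pose k' z := h1 z - c * z.
have dk (z : R) : is_derive z 1 k (k' z).
  have dq : is_derive z 1 (fun z : R => z ^+ 2) (2 * z).
    have := @is_deriveX R R id 2 z 1 1 (@is_derive_id _ _ z 1).
    by rewrite /GRing.scale/= mulr1 expr1.
  have -> : k' z = h1 z - (c / 2) *: (2 * z) by rewrite /k' /GRing.scale/=; field.
  exact: (@is_deriveB _ _ _ h (fun z => c / 2 * z ^+ 2) z 1 _ _ (dh z) (is_deriveZ _ dq)).
have [z [z1 z2 kz]] := mean_value x y dk.
have mono : 0 <= (k' z - k' x) * (y - x).
  have [->|zx] := eqVneq z x; first by rewrite subrr mul0r.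
  have sm : 0 <= (k' z - k' x) * (z - x).
    by have := derive_strongly_monotone z x; rewrite /k'; lra.
  case/orP: (le_total x y) => [xy|yx].
    rewrite (min_idPl xy) (max_idPr xy) in z1 z2.
    apply: mulr_ge0; last by lra.
    by rewrite -(pmulr_lge0 _ (_ : 0 < z - x))// subr_gt0 lt_neqAle eq_sym zx z1.
  rewrite (min_idPr yx) (max_idPl yx) in z1 z2.
  apply: mulr_le0; last by lra.
  by rewrite -(nmulr_lge0 _ (_ : z - x < 0))// subr_lt0 lt_neqAle zx z2.
by move: kz mono; rewrite /k /k' => kz mono; lra.
Qed.

Lemma midpoint_convexity x y :
  c / 4 * (x - y) ^+ 2 <= h x + h y - 2 * h ((x + y) / 2).
Proof.
have := strong_tangent ((x + y) / 2) x; have := strong_tangent ((x + y) / 2) y.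
set m := h _; set m1 := h1 _; set hx := h x; set hy := h y => *; lra.
Qed.

Lemma half_convexity x : 3 * c / 8 * x ^+ 2 <= h x - h (x / 2).
Proof.
have := strong_tangent (x / 2) x.
have := derive_strongly_monotone (x / 2) 0.
rewrite derive_even0; set m := h _; set m1 := h1 _; set hx := h x => *; lra.
Qed.

(** The deviation of the force [h'] from the force of the Gaussian potential
    [x ^ 2 / 2]. *)
Definition anharmonic x := h1 x - x.

Lemma anharmonic_odd x : anharmonic (- x) = - anharmonic x.
Proof. by rewrite /anharmonic derive_even_odd opprB opprK addrC. Qed.

Lemma anharmonic_lip x y :
  `|anharmonic x - anharmonic y| <= l * (`|x| + `|x - y|) * `|x - y|.
Proof.
have dr (z : R) : is_derive z 1 anharmonic (h2 z - 1) by exact: (@is_deriveB _ _ _ h1 id).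
have [z [z1 z2 ->]] := mean_value y x dr.
rewrite normrM ler_wpM2r//; apply: le_trans (h2l z) _; rewrite ler_wpM2l//.
have : `|z - x| <= `|x - y|.
  case/orP: (le_total x y) => [xy|yx].
    rewrite (min_idPr xy) (max_idPl xy) in z1 z2.
    by rewrite (distrC x) !ger0_norm ?subr_ge0//; lra.
  rewrite (min_idPl yx) (max_idPr yx) in z1 z2.
  by rewrite (distrC z) !ger0_norm ?subr_ge0//; lra.
move=> zx; have := ler_normD (z - x) x; rewrite subrK => ?; lra.
Qed.

Lemma anharmonic_bound x : `|anharmonic x| <= l * x ^+ 2.
Proof.
have r0 : anharmonic 0 = 0 by rewrite /anharmonic derive_even0 subr0.
have := anharmonic_lip 0 x; rewrite r0 !sub0r !normrN normr0 add0r.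
by rewrite -mulrA -expr2 real_normK ?num_real.
Qed.

Lemma derive_bound x : `|h1 x| <= `|x| + l * x ^+ 2.
Proof.
have -> : h1 x = x + anharmonic x by rewrite /anharmonic addrC subrK.
by apply: le_trans (ler_normD _ _) _; rewrite lerD2l anharmonic_bound.
Qed.

End strongly_convex_potential.
(** * Gibbs measures with strongly convex edge potentials *)

Lemma probability_integral_cst {R : realType} dT (T : measurableType dT)
  (mu : probability T R) (r : R) : (\int[mu]_x r%:E = r%:E)%E.
Proof.
rewrite (integral_cst mu measurableT).
by have /= -> := @probability_setT _ _ _ mu; rewrite mule1.
Qed.

Lemma is_derive_under_integral {R : realType} dT (T : measurableType dT)
    (mu : {measure set T -> \bar R}) (f f' : R -> T -> R) (G : T -> R) (u v t : R) :
  u < t < v ->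
  (forall s, u < s < v -> mu.-integrable setT (EFin \o f s)) ->
  (forall (s : R) x, u < s < v -> is_derive s 1 (f ^~ x) (f' s x)) ->
  mu.-integrable setT (EFin \o G) ->
  (forall s x, u < s < v -> `|f' s x| <= G x) ->
  is_derive t 1 (fun s => \int[mu]_x f s x) (\int[mu]_x f' t x).
Proof.
move=> tuv intf df intG f'G.
have inI s : `]u, v[%classic s -> u < s < v by rewrite /= in_itv.
have It : `]u, v[%classic t by rewrite /= in_itv.
have f'E s x : u < s < v -> partial1of2 f s x = f' s x.
  by move=> /(df s x) dfs; rewrite partial1of2E; exact: derive_val.
have G0 x : 0 <= G x by apply: le_trans (f'G t x tuv).
have intf1 s : `]u, v[%classic s -> mu.-integrable setT (EFin \o f s).
  by move=> /inI; exact: intf.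
have df1 (s : R) x : `]u, v[%classic s -> setT x -> derivable (f ^~ x) s 1.
  by move=> /inI suv _; case: (df s x suv).
have f'G1 s x : `]u, v[%classic s -> setT x -> `|partial1of2 f s x| <= G x.
  by move=> /inI suv _; rewrite f'E// f'G.
apply: DeriveDef; first exact: derivable_under_integral It intf1 df1 _ G0 intG f'G1.
rewrite -derive1E (differentiation_under_integral _ It intf1 df1 G0 intG f'G1)//.
by apply: eq_Rintegral => x _; exact: f'E.
Qed.

Lemma is_derive_bigsum {R : realType} (I : Type) (E : seq I) (g g' : I -> R -> R) (s : R) :
  (forall b, is_derive s 1 (g b) (g' b s)) ->
  is_derive s 1 (fun s => \sum_(b <- E) g b s) (\sum_(b <- E) g' b s).
Proof.
move=> dg; elim: E => [|b E IH].
  rewrite big_nil (_ : (fun _ => _) = cst 0); first exact: is_derive_cst.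
  by apply/funext => r; rewrite big_nil.
rewrite big_cons (_ : (fun _ => _) = g b + (fun s => \sum_(b <- E) g b s)).
  exact: is_deriveD.
by apply/funext => r; rewrite big_cons.
Qed.

Lemma is_derive_affine {R : realType} (u v s : R) :
  is_derive s 1 (fun s => u + s * v) v.
Proof.
have := @is_deriveD _ _ _ (cst u) _ s 1 _ _ (is_derive_cst _ _ _)
  (is_deriveZ v (@is_derive_id _ R s 1)).
rewrite add0r /GRing.scale/= mulr1 (_ : cst u + _ = fun s => u + s * v)//.
by apply/funext => r; rewrite mulrC.
Qed.

(** The configuration space is an abstract measurable space [T]: all that is used
    of the linear structure is how midpoints, the dilation [half], the reflection
    [neg] and the translations [shift s] act on the edge increments [A b] and on
    the reference measure [m]. *)
Section gibbs_estimates.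
Context {R : realType}.
Variables (h h1 h2 : R -> R) (c l : R).
Hypotheses (dh : forall x : R, is_derive x 1 h (h1 x))
           (dh1 : forall x : R, is_derive x 1 h1 (h2 x)).
Hypotheses (c0 : 0 < c) (h2c : forall x, c <= h2 x).
Hypotheses (l0 : 0 <= l) (h2l : forall x, `|h2 x - 1| <= l * `|x|).
Hypothesis h_even : forall x, h (- x) = h x.

Context {dT : measure_display} {T : measurableType dT}.
Variables (m : {measure set T -> \bar R}) (mu : probability T R).
Variables (mid : T -> T -> T) (half neg : T -> T) (shift : R -> T -> T).
Variables (I : Type) (E : seq I) (A : I -> T -> R) (a : I -> R) (alpha : R) (n : nat).
Hypotheses (mhalf : measurable_fun setT half) (mneg : measurable_fun setT neg)
           (mshift : forall s, measurable_fun setT (shift s)).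
Hypothesis PLm : prekopa_leindler mid m.
Hypothesis half_bound : forall f : T -> \bar R, measurable_fun setT f ->
  (forall x, 0 <= f x)%E ->
  (\int[m]_x f (half x) <= (2 ^+ n)%:E * \int[m]_x f x)%E.
Hypothesis neg_bound : forall f : T -> \bar R, measurable_fun setT f ->
  (forall x, 0 <= f x)%E -> (\int[m]_x f (neg x) <= \int[m]_x f x)%E.
Hypothesis shift_bound : forall s (f : T -> \bar R), measurable_fun setT f ->
  (forall x, 0 <= f x)%E -> (\int[m]_x f (shift s x) <= \int[m]_x f x)%E.
Hypotheses (mA : forall b, measurable_fun setT (A b))
  (A_mid : forall b x y, A b (mid x y) = (A b x + A b y) / 2)
  (A_half : forall b x, A b (half x) = A b x / 2)
  (A_neg : forall b x, A b (neg x) = - A b x)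
  (negK : forall x, neg (neg x) = x)
  (A_shift : forall b s x, A b (shift s x) = A b x + s * a b)
  (shiftK : forall s x, shift s (shift (- s) x) = x).
Hypotheses (alpha0 : 0 <= alpha) (a_alpha : forall b, `|a b| <= alpha).

Let energy x := \sum_(b <- E) h (A b x).
Variable Zi : R.
Hypothesis Zi0 : 0 < Zi.
Let p x := Zi * expR (- energy x).
Hypothesis law : forall G : T -> \bar R, measurable_fun setT G ->
  (forall x, 0 <= G x)%E -> (\int[mu]_x G x = \int[m]_x (G x * (p x)%:E))%E.

Let S x := \sum_(b <- E) A b x ^+ 2.
Let X x := \sum_(b <- E) a b * A b x.
Let Y x := \sum_(b <- E) a b * h1 (A b x).
Let F x := \sum_(b <- E) a b * anharmonic h1 (A b x).
Let sigma2 := \sum_(b <- E) a b ^+ 2.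
Let N := (size E)%:R : R.

(* [W] has finite expectation and dominates all the integrands below. *)
Let W x := expR (3 * c / 8 * S x).

Let mh : measurable_fun setT h.
Proof.
apply: continuous_measurable_fun => x; apply: differentiable_continuous.
by apply/derivable1_diffP; case: (dh x).
Qed.

Let mh1 : measurable_fun setT h1.
Proof.
apply: continuous_measurable_fun => x; apply: differentiable_continuous.
by apply/derivable1_diffP; case: (dh1 x).
Qed.

Let mS : measurable_fun setT S.
Proof. by apply: measurable_sum => b; exact: measurable_funX. Qed.

Let mX : measurable_fun setT X.
Proof. by apply: measurable_sum => b; exact: measurable_funM. Qed.

Let mY : measurable_fun setT Y.
Proof.
by apply: measurable_sum => b; apply: measurable_funM => //; exact: measurableT_comp.
Qed.

Let mF : measurable_fun setT F.
Proof.
apply: measurable_sum => b; apply: measurable_funM => //.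
by apply: measurable_funB => //; exact: measurableT_comp.
Qed.

Let menergy : measurable_fun setT energy.
Proof. by apply: measurable_sum => b; exact: measurableT_comp. Qed.

Let mp : measurable_fun setT p.
Proof.
apply: measurable_funM => //; apply: measurableT_comp => //.
exact: measurableT_comp.
Qed.

Let p0 x : 0 < p x. Proof. by rewrite mulr_gt0// expR_gt0. Qed.

Let S0 x : 0 <= S x. Proof. by apply: sumr_ge0 => b _; exact: sqr_ge0. Qed.

Let mW : measurable_fun setT W.
Proof. by apply: measurableT_comp => //; exact: measurable_funM. Qed.

Let int1 : (\int[m]_x (p x)%:E = 1)%E.
Proof.
have := @law (cst 1%E) (measurable_cst _) (fun=> lee01).
rewrite probability_integral_cst => ->.
by apply: eq_integral => x _; rewrite mul1e.
Qed.

Let neg_inv (f : T -> \bar R) : measurable_fun setT f -> (forall x, 0 <= f x)%E ->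
  (\int[m]_x f (neg x) = \int[m]_x f x)%E.
Proof.
move=> mf f0; apply/eqP; rewrite eq_le neg_bound//=.
have := @neg_bound (f \o neg).
have -> : (\int[m]_x (f \o neg) (neg x) = \int[m]_x f x)%E.
  by apply: eq_integral => x _ /=; rewrite negK.
by apply => [|x]; [exact: measurableT_comp|exact: f0].
Qed.

Let shift_inv s (f : T -> \bar R) : measurable_fun setT f -> (forall x, 0 <= f x)%E ->
  (\int[m]_x f (shift s x) = \int[m]_x f x)%E.
Proof.
move=> mf f0; apply/eqP; rewrite eq_le shift_bound//=.
have := @shift_bound (- s) (f \o shift s).
have -> : (\int[m]_x (f \o shift s) (shift (- s) x) = \int[m]_x f x)%E.
  by apply: eq_integral => x _ /=; rewrite shiftK.
by apply => [|x]; [exact: measurableT_comp|exact: f0].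
Qed.

(** Dilating by 1/2 multiplies the total mass by at most [2 ^ n], while it
    lowers the energy by at least [3 * c / 8 * S]. *)
Lemma exponential_moment : (\int[mu]_x (W x)%:E <= (2 ^+ n)%:E)%E.
Proof.
rewrite law//; [|exact/measurable_EFinP|by move=> x; rewrite lee_fin expR_ge0].
apply: (@le_trans _ _ (\int[m]_x (p (half x))%:E)%E); last first.
  apply: le_trans (@half_bound (EFin \o p) _ _) _.
  - exact/measurable_EFinP.
  - by move=> x; rewrite lee_fin ltW.
  - by rewrite int1 mule1.
apply: ge0_le_integral => //.
- by move=> x _; rewrite -EFinM lee_fin mulr_ge0 ?expR_ge0 ?ltW.
- by apply/measurable_EFinP; exact: measurable_funM.
- by apply/measurable_EFinP; exact: measurableT_comp.
move=> x _; rewrite -EFinM lee_fin /p /W mulrCA; apply: ler_wpM2l; first exact: ltW.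
rewrite -expRD ler_expR.
suff : 3 * c / 8 * S x <= energy x - energy (half x) by move=> *; lra.
rewrite -sumrB mulr_sumr; apply: ler_sum => b _; rewrite A_half.
exact: (half_convexity dh dh1 h2c h_even).
Qed.

(** Jensen's inequality applied to the exponential moment, in the form
    [1 + y <= exp y] with [y] recentred at [n]. *)
Lemma second_moment : (\int[mu]_x (S x)%:E <= (8 / (3 * c) * n%:R)%:E)%E.
Proof.
have k0 : 0 < 3 * c / 8 by rewrite divr_gt0// mulr_gt0.
rewrite -(@lee_pmul2l _ (3 * c / 8)%:E)// -ge0_integralZl_EFin//; first last.
- exact: ltW.
- exact/measurable_EFinP.
- by move=> x _; rewrite lee_fin.
rewrite -EFinM (_ : _ * (_ * _) = n%:R); last by field; rewrite gt_eqF.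
rewrite -(@leeD2rE _ 1%E)//.
have -> : (\int[mu]_x ((3 * c / 8)%:E * (S x)%:E) + 1 =
    \int[mu]_x (3 * c / 8 * S x + 1)%:E)%E.
  under [RHS]eq_integral do rewrite EFinD EFinM.
  rewrite ge0_integralD//; first by rewrite probability_integral_cst.
  - by move=> x _; rewrite -EFinM lee_fin mulr_ge0// ltW.
  - by apply/measurable_EFinP; exact: measurable_funM.
apply: (@le_trans _ _ (\int[mu]_x (n%:R + (2 ^+ n)^-1 * W x)%:E)%E).
  apply: ge0_le_integral => //.
  - by move=> x _; rewrite lee_fin addr_ge0// mulr_ge0// ltW.
  - by apply/measurable_EFinP; apply: measurable_funD => //; exact: measurable_funM.
  - by apply/measurable_EFinP; apply: measurable_funD => //; exact: measurable_funM.
  move=> x _; rewrite lee_fin -lerBlDl addrAC.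
  have := expR_ge1Dx (3 * c / 8 * S x - n%:R); rewrite addrC => /le_trans; apply.
  rewrite expRD mulrC ler_wpM2r ?expR_ge0// expRN lef_pV2 ?posrE ?expR_gt0 ?exprn_gt0//.
  have -> : expR n%:R = expR 1 ^+ n :> R by rewrite -expRM_natl mulr1.
  apply: lerXn2r; rewrite ?nnegrE ?expR_ge0//.
  by have := expR_ge1Dx (1 : R); lra.
have -> : (\int[mu]_x (n%:R + (2 ^+ n)^-1 * W x)%:E =
    n%:R%:E + ((2 ^+ n)^-1)%:E * \int[mu]_x (W x)%:E)%E.
  under eq_integral do rewrite EFinD EFinM.
  rewrite ge0_integralD//.
  - by rewrite probability_integral_cst ge0_integralZl_EFin ?invr_ge0 ?exprn_ge0//;
      [move=> x _; rewrite lee_fin expR_ge0|exact/measurable_EFinP].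
  - by move=> x _; rewrite -EFinM lee_fin mulr_ge0 ?invr_ge0 ?exprn_ge0 ?expR_ge0.
  - by apply/measurable_EFinP; exact: measurable_funM.
rewrite leeD2lE// -[leRHS](_ : ((2 ^+ n)^-1)%:E * (2 ^+ n)%:E = 1)%E.
  by rewrite lee_pmul2l// ?lte_fin ?invr_gt0 ?exprn_gt0// exponential_moment.
by rewrite -EFinM mulVf// gt_eqF// exprn_gt0.
Qed.

Section anharmonic_part.
Variable lam : R.
Hypotheses (lam0 : 0 < lam) (small : lam * alpha * l <= c / 8).

Let q := lam * alpha * l.
(* chosen so that [q * s * e <= cutoff * s ^ 2 + c / 8 * e ^ 2] *)
Let cutoff := 2 * q ^+ 2 / c.
Let tilt (e : R) x := expR (e * (lam * F x) - cutoff * S x).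

Let mtilt e : measurable_fun setT (tilt e).
Proof.
apply: measurableT_comp => //; apply: measurable_funB; last exact: measurable_funM.
by apply: measurable_funM => //; exact: measurable_funM.
Qed.

Let tilt_neg e x : tilt e (neg x) = tilt (- e) x.
Proof.
rewrite /tilt; congr expR; congr (_ - cutoff * _).
  rewrite mulNr -mulrN -mulrN -sumrN; congr (_ * (_ * _)).
  by apply: eq_bigr => b _; rewrite A_neg (anharmonic_odd dh h_even) mulrN.
by apply: eq_bigr => b _; rewrite A_neg sqrrN.
Qed.

Let p_neg x : p (neg x) = p x.
Proof.
rewrite /p; congr (_ * expR (- _)).
by apply: eq_bigr => b _; rewrite A_neg h_even.
Qed.

(* Edge by edge, the modulus of convexity [c / 4 * (u - v) ^ 2] absorbs the
   increment of the anharmonic force up to the cutoff. *)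
Let tilt_midpoint x y :
  (tilt 1 x * p x) * (tilt (-1) y * p y) <= p (mid x y) * p (mid x y).
Proof.
have -> : tilt 1 x * p x * (tilt (-1) y * p y) =
    Zi * Zi * expR (lam * (F x - F y) - cutoff * S x - cutoff * S y
                    - energy x - energy y).
  have -> : lam * (F x - F y) - cutoff * S x - cutoff * S y - energy x - energy y
    = (1 * (lam * F x) - cutoff * S x) + (- energy x) +
      ((-1 * (lam * F y) - cutoff * S y) + (- energy y)) by ring.
  by rewrite /tilt /p !expRD; ring.
have -> : p (mid x y) * p (mid x y) = Zi * Zi * expR (- 2 * energy (mid x y)).
  have -> : - 2 * energy (mid x y) = - energy (mid x y) - energy (mid x y) by ring.
  by rewrite /p expRD; ring.
apply: ler_wpM2l; first by rewrite mulr_ge0 ?(ltW Zi0).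
rewrite ler_expR.
suff : lam * (F x - F y) - cutoff * S x - cutoff * S y <=
    energy x + energy y - 2 * energy (mid x y).
  move: (F x) (F y) (S x) (S y) (energy x) (energy y) (energy (mid x y)) => *; lra.
have cut0 : 0 <= cutoff by rewrite divr_ge0 ?(ltW c0)// mulr_ge0// sqr_ge0.
apply: (@le_trans _ _ (lam * (F x - F y) - cutoff * S x)).
  by rewrite lerBlDr lerDl mulr_ge0.
rewrite /F /S /energy -sumrB !mulr_sumr -sumrB -big_split/= -sumrB.
apply: ler_sum => b _; rewrite A_mid.
apply: le_trans (midpoint_convexity dh dh1 h2c _ _).
set u := A b x; set v := A b y.
have q0 : 0 <= q by rewrite !mulr_ge0// ?(ltW lam0)// (le_trans _ (a_alpha b)).
have force : lam * (a b * anharmonic h1 u - a b * anharmonic h1 v) <=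
    q * ((`|u| + `|u - v|) * `|u - v|).
  apply: le_trans (ler_norm _) _; rewrite -mulrBr !normrM (gtr0_norm lam0).
  rewrite /q -!mulrA; apply: ler_wpM2l; first exact: ltW.
  apply: ler_pM => //; rewrite mulrA.
  exact: (anharmonic_lip dh1 l0 h2l).
have -> : u ^+ 2 = `|u| ^+ 2 by rewrite real_normK ?num_real.
have -> : (u - v) ^+ 2 = `|u - v| ^+ 2 by rewrite real_normK ?num_real.
rewrite lerBlDr; apply: le_trans force _.
move: `|u| `|u - v| (normr_ge0 u) (normr_ge0 (u - v)) => s e s0 e0.
have qe : q * e ^+ 2 <= c / 8 * e ^+ 2 by rewrite ler_wpM2r ?sqr_ge0.
have : 0 <= 2 / c * (q * s - c / 4 * e) ^+ 2.
  by rewrite mulr_ge0 ?sqr_ge0// divr_ge0 ?(ltW c0).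
have -> : 2 / c * (q * s - c / 4 * e) ^+ 2 =
    cutoff * s ^+ 2 - q * s * e + c / 8 * e ^+ 2.
  by rewrite /cutoff; field; rewrite gt_eqF.
by move: qe; set k := cutoff * _; rewrite mulrDl mulrDr -expr2 mulrA => *; lra.
Qed.

Let tilt_sym : (\int[mu]_x (tilt (-1) x)%:E = \int[mu]_x (tilt 1 x)%:E)%E.
Proof.
have lawt e : (\int[mu]_x (tilt e x)%:E = \int[m]_x (tilt e x * p x)%:E)%E.
  rewrite law//.
  - exact/measurable_EFinP.
  - by move=> x; rewrite lee_fin expR_ge0.
rewrite !lawt; transitivity (\int[m]_x (tilt 1 (neg x) * p (neg x))%:E)%E.
  by apply: eq_integral => x _; rewrite tilt_neg p_neg.
apply: (@neg_inv (fun x => (tilt 1 x * p x)%:E)).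
- by apply/measurable_EFinP; exact: measurable_funM.
- by move=> x; rewrite lee_fin mulr_ge0 ?expR_ge0 ?ltW.
Qed.

(* The two tilted integrals agree by symmetry and their product is at most 1. *)
Let tilt_moment : (\int[mu]_x (tilt 1 x)%:E <= 1)%E.
Proof.
have lawt e : (\int[mu]_x (tilt e x)%:E = \int[m]_x (tilt e x * p x)%:E)%E.
  rewrite law//.
  - exact/measurable_EFinP.
  - by move=> x; rewrite lee_fin expR_ge0.
have mtp e : measurable_fun setT (fun x => (tilt e x * p x)%:E).
  by apply/measurable_EFinP; exact: measurable_funM.
have tp0 e x : (0 <= (tilt e x * p x)%:E)%E.
  by rewrite lee_fin mulr_ge0 ?expR_ge0 ?ltW.
have := PLm (mtp 1) (mtp (-1)) (_ : measurable_fun setT (EFin \o p)) (tp0 1) (tp0 (-1)).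
rewrite -!lawt tilt_sym => /(_ _ _ _).
have -> : (\int[m]_x (EFin \o p) x = 1)%E := int1.
rewrite mule1 => sq.
have {}sq : (\int[mu]_x (tilt 1 x)%:E * \int[mu]_x (tilt 1 x)%:E <= 1)%E.
  apply: sq => [|x|x y]; first exact/measurable_EFinP.
    by rewrite lee_fin ltW.
  by rewrite -!EFinM lee_fin tilt_midpoint.
have : (0 <= \int[mu]_x (tilt 1 x)%:E)%E.
  by apply: integral_ge0 => x _; rewrite lee_fin expR_ge0.
case: (\int[mu]_x _)%E sq => [z| |]; rewrite ?mulyy// -EFinM !lee_fin => z2 z0.
by rewrite -(@ler_pXn2r _ 2)// ?nnegrE// expr1n expr2.
Qed.

Let second_moment_bound := 8 / (3 * c) * n%:R.

Definition anharmonic_error := (1 + cutoff * second_moment_bound) / lam.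

(** From [1 + y <= exp y] with [y = lam * |F| - cutoff * S], whose exponential is
    bounded by the sum of the two tilts. *)
Lemma anharmonic_moment : (\int[mu]_x (`|F x|)%:E <= anharmonic_error%:E)%E.
Proof.
have cut0 : 0 <= cutoff by rewrite divr_ge0 ?(ltW c0)// mulr_ge0// sqr_ge0.
have mt e : measurable_fun setT (fun x => (tilt e x)%:E) by exact/measurable_EFinP.
have t0 e x : (0 <= (tilt e x)%:E)%E by rewrite lee_fin expR_ge0.
have mnF : measurable_fun setT (fun x => `|F x|) by exact: measurableT_comp.
have key : (\int[mu]_x (lam * `|F x| + 1)%:E <=
    \int[mu]_x ((tilt 1 x)%:E + (tilt (-1) x)%:E + (cutoff * S x)%:E))%E.
  apply: ge0_le_integral => //.
  - by move=> x _; rewrite lee_fin addr_ge0// mulr_ge0// ltW.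
  - by apply/measurable_EFinP; apply: measurable_funD => //; exact: measurable_funM.
  - apply: emeasurable_funD; first exact: emeasurable_funD.
    by apply/measurable_EFinP; exact: measurable_funM.
  move=> x _; rewrite -!EFinD lee_fin -lerBlDr.
  have tilt_abs : expR (lam * `|F x| - cutoff * S x) <= tilt 1 x + tilt (-1) x.
    rewrite /tilt mul1r mulN1r; have [F0|F0] := leP 0 (F x).
      by rewrite ger0_norm// lerDl expR_ge0.
    by rewrite ltr0_norm// mulrN lerDr expR_ge0.
  apply: le_trans tilt_abs; apply: le_trans (expR_ge1Dx _).
  by rewrite addrAC addrC addrA.
have : ((lam%:E * \int[mu]_x (`|F x|)%:E) + 1 <=
    1 + (1 + cutoff%:E * second_moment_bound%:E))%E.
  have <- : (\int[mu]_x (lam * `|F x| + 1)%:E = lam%:E * \int[mu]_x (`|F x|)%:E + 1)%E.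
    under eq_integral do rewrite EFinD EFinM.
    rewrite ge0_integralD//.
    - rewrite probability_integral_cst ge0_integralZl_EFin//.
        exact/measurable_EFinP.
      exact: ltW.
    - by move=> x _; rewrite -EFinM lee_fin mulr_ge0// ltW.
    - by apply/measurable_EFinP; exact: measurable_funM.
  apply: le_trans key _.
  rewrite ge0_integralD//; first last.
  - by apply/measurable_EFinP; exact: measurable_funM.
  - by move=> x _; rewrite lee_fin mulr_ge0.
  - exact: emeasurable_funD.
  - by move=> x _; rewrite adde_ge0.
  rewrite ge0_integralD// tilt_sym (addeA 1%E 1%E); apply: leeD.
    by apply: leeD; exact: tilt_moment.
  under eq_integral do rewrite EFinM.
  rewrite ge0_integralZl_EFin//; first exact: lee_wpmul2l second_moment.
  - by move=> x _; rewrite lee_fin.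
  - exact/measurable_EFinP.
rewrite addeC leeD2lE// => bound; rewrite -(@lee_pmul2l _ lam%:E)//.
apply: le_trans bound _.
rewrite -EFinM -EFinD -EFinM lee_fin /anharmonic_error.
by rewrite [lam * _]mulrC divfK ?gt_eqF.
Qed.

End anharmonic_part.

Section characteristic_function.

Let dominated (K : R) (G : T -> R) : measurable_fun setT G ->
  (forall x, `|G x| <= K * W x) -> mu.-integrable setT (EFin \o G).
Proof.
move=> mG GK.
have intW : mu.-integrable setT (EFin \o (fun x => W x)).
  apply/integrableP; split; first exact/measurable_EFinP.
  apply: (@le_lt_trans _ _ (2 ^+ n)%:E); last by rewrite ltry.
  apply: le_trans exponential_moment.
  apply: ge0_le_integral => //; do ?by apply/measurable_EFinP.
    by apply/measurable_EFinP; apply: measurableT_comp => //.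
  by move=> x _; rewrite /= lee_fin ger0_norm ?expR_ge0.
apply: (@le_integrable _ _ _ mu _ measurableT _ (fun x => K%:E * (EFin \o W) x)%E).
- exact/measurable_EFinP.
- move=> x _; rewrite /= lee_fin; apply: le_trans (GK x) _; exact: ler_norm.
- exact: integrableZl.
Qed.

Let expS x := expR (c / 8 * S x).

Let expS1 x : 1 <= expS x.
Proof. by rewrite -expR0 ler_expR mulr_ge0// divr_ge0 ?(ltW c0). Qed.

Let expS_S x : S x <= 8 / c * expS x.
Proof.
have -> : S x = 8 / c * (c / 8 * S x) by field; rewrite gt_eqF.
rewrite ler_wpM2l ?divr_ge0 ?(ltW c0)//.
by apply: le_trans (expR_ge1Dx _); lra.
Qed.

Let expS_W x : expS x * expS x <= W x.
Proof. by rewrite -expRD ler_expR /W; have := S0 x; have := c0; nra. Qed.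

Let expSW x : expS x <= W x.
Proof. by apply: le_trans (expS_W x); rewrite ler_peMl ?expS1// expR_ge0. Qed.

Let X_shift s x : X (shift s x) = X x + s * sigma2.
Proof.
rewrite /X /sigma2 mulr_sumr -big_split/=; apply: eq_bigr => b _.
by rewrite A_shift; ring.
Qed.

Let abs_le_sqr (z : R) : `|z| <= 1 + z ^+ 2.
Proof.
have -> : z ^+ 2 = `|z| ^+ 2 by rewrite real_normK ?num_real.
by have := sqr_ge0 (`|z| - 1); have := normr_ge0 z; nra.
Qed.

Let X_bound x : `|X x| <= alpha * N + alpha * S x.
Proof.
apply: le_trans (ler_norm_sum _ _ _) _.
rewrite /N -sum1_size natr_sum !mulr_sumr -big_split/=.
apply: ler_sum => b _; rewrite normrM mulr1 -[X in X + _]mulr1 -mulrDr.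
exact: ler_pM.
Qed.

(* For translations by less than [s0] the density ratio is at most a constant
   times [expS], which leaves room for one more factor [expS] below [W]. *)
Let s0 := Num.min 1 (c / (8 * (alpha + 1) * (1 + l))).

Let s00 : 0 < s0.
Proof.
have := alpha0; have := l0; have := c0 => *.
by rewrite lt_min ltr01/= divr_gt0// !mulr_gt0//; lra.
Qed.

Let s0_small (s : R) : - s0 < s < s0 -> `|s| <= 1 /\ `|s| * (alpha * (1 + l)) <= c / 8.
Proof.
rewrite -ltr_norml lt_min => /andP[s1 sc]; split; first exact: ltW.
have l1 : 0 < 1 + l by have := l0; lra.
have al1 : 0 < alpha + 1 by have := alpha0; lra.
rewrite ltr_pdivlMr ?mulr_gt0// in sc.
have : `|s| * (alpha * (1 + l)) <= `|s| * ((alpha + 1) * (1 + l)).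
  by rewrite ler_wpM2l// ler_wpM2r ?(ltW l1)//; lra.
by move/le_trans; apply; move: sc; set k := `|s| * _ => ?; rewrite /k; nra.
Qed.

Let ratio s x := expR (energy x - energy (shift s x)).

Let slope_bound (s : R) b x :
  `|s| <= 1 -> `|h1 (A b x)| * (`|s| * `|a b|) <= alpha + `|s| * (alpha * (1 + l)) * A b x ^+ 2.
Proof.
move=> s1; apply: (@le_trans _ _ ((1 + (1 + l) * A b x ^+ 2) * (`|s| * alpha))).
  apply: ler_pM; rewrite ?mulr_ge0//; last by rewrite ler_wpM2l.
  apply: le_trans (derive_bound dh dh1 l0 h2l h_even _) _.
  by have := abs_le_sqr (A b x); lra.
rewrite mulrDl mul1r; apply: lerD; first by rewrite ler_piMl.
by rewrite le_eqVlt; apply/orP; left; apply/eqP; ring.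
Qed.

Let ratio_bound s x : - s0 < s < s0 -> ratio s x <= expR (alpha * N) * expS x.
Proof.
move=> /s0_small[s1 sc]; rewrite -expRD ler_expR.
apply: (@le_trans _ _ (\sum_(b <- E) (alpha + `|s| * (alpha * (1 + l)) * A b x ^+ 2))).
  rewrite /energy -sumrB; apply: ler_sum => b _; rewrite A_shift.
  have := strong_tangent dh dh1 h2c (A b x) (A b x + s * a b).
  rewrite (_ : A b x + s * a b - A b x = s * a b); last by ring.
  have q0 : 0 <= c / 2 * (s * a b) ^+ 2.
    by rewrite mulr_ge0 ?sqr_ge0// divr_ge0// ltW.
  move=> tan; apply: (@le_trans _ _ (- (h1 (A b x) * (s * a b)))); first by lra.
  apply: le_trans (ler_norm _) _; rewrite normrN !normrM.
  exact: slope_bound.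
rewrite big_split/= -mulr_sumr; apply: lerD.
  by rewrite /N -sum1_size natr_sum mulr_sumr; apply: ler_sum => b _; rewrite mulr1.
exact: ler_wpM2r (S0 x) _ _ sc.
Qed.

Let force_bound s x : - s0 < s < s0 ->
  `|Y (shift s x)| <=
  (alpha * N * (1 + 2 * (1 + l) * alpha ^+ 2) + 16 / c * alpha * (1 + l)) * expS x.
Proof.
move=> /s0_small[s1 _].
apply: (@le_trans _ _ (\sum_(b <- E) (alpha * (1 + 2 * (1 + l) * alpha ^+ 2) +
    2 * alpha * (1 + l) * A b x ^+ 2))).
  apply: le_trans (ler_norm_sum _ _ _) _; apply: ler_sum => b _.
  rewrite A_shift normrM; set z := A b x + _.
  have z2 : z ^+ 2 <= 2 * A b x ^+ 2 + 2 * alpha ^+ 2.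
    apply: (@le_trans _ _ (2 * A b x ^+ 2 + 2 * (s * a b) ^+ 2)).
      by rewrite /z; have := sqr_ge0 (A b x - s * a b); nra.
    rewrite lerD2l ler_wpM2l// -(real_normK (num_real (s * a b))).
    apply: lerXn2r; rewrite ?nnegrE// normrM -[leRHS]mul1r.
    exact: ler_pM.
  have -> : alpha * (1 + 2 * (1 + l) * alpha ^+ 2) + 2 * alpha * (1 + l) * A b x ^+ 2 =
    alpha * (1 + (1 + l) * (2 * A b x ^+ 2 + 2 * alpha ^+ 2)) by ring.
  apply: ler_pM => //; apply: le_trans (derive_bound dh dh1 l0 h2l h_even z) _.
  apply: (@le_trans _ _ (1 + (1 + l) * z ^+ 2)).
    by have := abs_le_sqr z; lra.
  by rewrite lerD2l ler_wpM2l// addr_ge0.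
rewrite big_split/= [leRHS]mulrDl; apply: lerD.
  rewrite (_ : \sum_(b <- E) _ = alpha * N * (1 + 2 * (1 + l) * alpha ^+ 2)).
    apply: ler_peMr; rewrite ?expS1//.
    by rewrite !(mulr_ge0, addr_ge0, ler0n, sqr_ge0).
  rewrite /N -sum1_size natr_sum mulr_sumr mulr_suml.
  by apply: eq_bigr => b _; rewrite mulr1.
rewrite -mulr_sumr.
have -> : 16 / c * alpha * (1 + l) * expS x = 2 * alpha * (1 + l) * (8 / c * expS x).
  by field; rewrite gt_eqF.
apply: ler_wpM2l; last exact: expS_S.
by rewrite !(mulr_ge0, addr_ge0).
Qed.

Let Y_shift0 x : Y (shift 0 x) = Y x.
Proof. by apply: eq_bigr => b _; rewrite A_shift mul0r addr0. Qed.

Let ratio0 x : ratio 0 x = 1.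
Proof.
rewrite /ratio (_ : energy (shift 0 x) = energy x) ?subrr ?expR0//.
by apply: eq_bigr => b _; rewrite A_shift mul0r addr0.
Qed.

(* The term 1 makes the integrand nonnegative, so that the invariance of [m]
   applies without integrability conditions. *)
Let test t s x := ratio s x * (1 + sin (t * (X x + s * sigma2))).

Let test' t s x := ratio s x * (- Y (shift s x)) * (1 + sin (t * (X x + s * sigma2))) +
  ratio s x * (cos (t * (X x + s * sigma2)) * (t * sigma2)).

Let is_derive_ratio x (s : R) :
  is_derive s 1 (ratio ^~ x) (ratio s x * (- Y (shift s x))).
Proof.
have dE : is_derive s 1 (fun s => energy (shift s x)) (Y (shift s x)).
  rewrite (_ : (fun s => _) = (fun s => \sum_(b <- E) h (A b x + s * a b))); last first.
    by apply/funext => r; apply: eq_bigr => b _; rewrite A_shift.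
  rewrite (_ : Y _ = \sum_(b <- E) h1 (A b x + s * a b) * a b); last first.
    by apply: eq_bigr => b _; rewrite A_shift mulrC.
  apply: (@is_derive_bigsum _ _ _ (fun b s => h (A b x + s * a b))
    (fun b s => h1 (A b x + s * a b) * a b)) => b.
  by apply: (@is_derive1_comp _ h (fun s => A b x + s * a b)) => //; exact: is_derive_affine.
apply: (@is_derive1_comp _ expR (fun s => energy x - energy (shift s x))).
have := @is_deriveB _ _ _ (cst (energy x)) _ s 1 _ _ (is_derive_cst _ _ _) dE.
by rewrite sub0r.
Qed.

Let is_derive_test t x (s : R) : is_derive s 1 (test t ^~ x) (test' t s x).
Proof.
have dphase : is_derive s 1 (fun s => t * (X x + s * sigma2)) (t * sigma2).
  exact: (is_deriveZ t (is_derive_affine (X x) sigma2 s)).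
have dsin : is_derive s 1 (fun s => 1 + sin (t * (X x + s * sigma2)))
    (cos (t * (X x + s * sigma2)) * (t * sigma2)).
  have ds := @is_derive1_comp _ sin _ s _ _ (is_derive_sin _) dphase.
  have := @is_deriveD R R R (cst (1 : R)) _ s 1 _ _ (is_derive_cst _ _ _) ds.
  by rewrite add0r.
have := is_deriveM (is_derive_ratio x s) dsin.
rewrite /test' /GRing.scale/= => dM; apply: is_derive_eq dM _.
by rewrite addrC; congr (_ + _); rewrite mulrC.
Qed.

Let K1 := alpha * N * (1 + 2 * (1 + l) * alpha ^+ 2) + 16 / c * alpha * (1 + l).

Let K10 : 0 <= K1.
Proof. by rewrite !(addr_ge0, mulr_ge0, invr_ge0, sqr_ge0, ler0n, ltW c0). Qed.

Let msin (k : R) g : measurable_fun setT g -> measurable_fun setT (fun x : T => sin (k * g x)).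
Proof.
move=> mg; apply: (measurableT_comp (f := @sin R)).
  by apply: continuous_measurable_fun => x; exact: continuous_sin.
exact: measurable_funM.
Qed.

Let mcos (k : R) g : measurable_fun setT g -> measurable_fun setT (fun x : T => cos (k * g x)).
Proof.
move=> mg; apply: (measurableT_comp (f := @cos R)).
  by apply: continuous_measurable_fun => x; exact: continuous_cos.
exact: measurable_funM.
Qed.

Let sin_norm (z : R) : `|sin z| <= 1.
Proof. by rewrite ler_norml sin_geN1 sin_le1. Qed.

Let cos_norm (z : R) : `|cos z| <= 1.
Proof. by rewrite ler_norml cos_geN1 cos_le1. Qed.

Let sin1_norm (z : R) : `|1 + sin z| <= 2.
Proof. by rewrite ler_norml; have := sin_geN1 z; have := sin_le1 z => *; lra. Qed.

Let mtest t s : measurable_fun setT (test t s).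
Proof.
apply: measurable_funM.
  apply: measurableT_comp => //; apply: measurable_funB => //.
  exact: measurableT_comp.
by apply: measurable_funD => //; apply: msin; exact: measurable_funD.
Qed.

Let test_integrable t s : - s0 < s < s0 -> mu.-integrable setT (EFin \o test t s).
Proof.
move=> ss; apply: (@dominated (2 * expR (alpha * N))) => // x.
rewrite normrM (ger0_norm (expR_ge0 _)) mulrC -mulrA.
apply: ler_pM => //; rewrite ?expR_ge0//.
apply: le_trans (ratio_bound x ss) _.
by apply: ler_wpM2l; rewrite ?expR_ge0.
Qed.

Let test'_bound t s x : - s0 < s < s0 ->
  `|test' t s x| <= expR (alpha * N) * (2 * K1 + `|t * sigma2|) * W x.
Proof.
move=> ss; apply: le_trans (ler_normD _ _) _.
have r0 : 0 <= ratio s x by exact: expR_ge0.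
have E0 : 0 <= expR (alpha * N) by exact: expR_ge0.
have e0 : 0 <= expS x by exact: expR_ge0.
rewrite [leRHS](_ : _ = expR (alpha * N) * (2 * K1) * W x +
  expR (alpha * N) * `|t * sigma2| * W x); last by ring.
apply: lerD.
  rewrite !normrM normrN (ger0_norm r0).
  apply: (@le_trans _ _ (expR (alpha * N) * expS x * (K1 * expS x) * 2)).
    apply: ler_pM => //; first by rewrite mulr_ge0.
    by apply: ler_pM => //; [exact: ratio_bound|exact: force_bound].
  rewrite (_ : _ * 2 = expR (alpha * N) * (2 * K1) * (expS x * expS x)); last by ring.
  by apply: ler_wpM2l; rewrite ?mulr_ge0.
rewrite normrM (ger0_norm r0) normrM.
apply: (@le_trans _ _ (expR (alpha * N) * expS x * (1 * `|t * sigma2|))).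
  apply: ler_pM => //; first exact: ratio_bound.
  exact: ler_wpM2r.
rewrite mul1r mulrAC; apply: ler_wpM2l; rewrite ?mulr_ge0//.
Qed.

Let integral_test t s : \int[mu]_x test t s x = \int[mu]_x test t 0 x.
Proof.
have testE r : (\int[mu]_x (test t r x)%:E = \int[m]_x ((1 + sin (t * X x)) * p x)%:E)%E.
  have sin0 x : 0 <= 1 + sin x :> R by have := sin_geN1 x; lra.
  rewrite law; last 2 first.
  - exact/measurable_EFinP.
  - by move=> x; rewrite lee_fin mulr_ge0 ?expR_ge0.
  rewrite -[RHS](@shift_inv r (fun x => ((1 + sin (t * X x)) * p x)%:E)).
  - apply: eq_integral => x _; rewrite -EFinM; congr EFin.
    rewrite X_shift /test /p (_ : expR (- energy (shift r x)) =
      ratio r x * expR (- energy x)); first by ring.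
    by rewrite /ratio -expRD; congr expR; ring.
  - apply/measurable_EFinP; apply: measurable_funM => //.
    by apply: measurable_funD => //; exact: msin.
  - by move=> x; rewrite lee_fin mulr_ge0// ltW.
by rewrite /Rintegral !testE.
Qed.

Let test_stationary t : \int[mu]_x (- Y x * (1 + sin (t * X x)) + cos (t * X x) * (t * sigma2)) = 0.
Proof.
have zero_in : - s0 < 0 < s0 by rewrite oppr_lt0 s00.
have d0 : is_derive (0 : R) 1 (fun s => \int[mu]_x test t s x) (\int[mu]_x test' t 0 x).
  apply: (@is_derive_under_integral _ _ _ mu (test t) (test' t)
    (fun x => expR (alpha * N) * (2 * K1 + `|t * sigma2|) * W x) (- s0) s0) => //.
  - by move=> s; exact: test_integrable.
  - apply: (@dominated (expR (alpha * N) * (2 * K1 + `|t * sigma2|))) => [|x].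
      exact: measurable_funM.
    rewrite ger0_norm// /W mulr_ge0 ?expR_ge0// mulr_ge0 ?expR_ge0//.
    by rewrite addr_ge0// mulr_ge0.
  - by move=> s x; exact: test'_bound.
rewrite -[RHS](derive1_cst (\int[mu]_x test t 0 x) (0 : R)).
rewrite (_ : cst _ = (fun s => \int[mu]_x test t s x)); last first.
  by apply/funext => s; rewrite integral_test.
rewrite derive1E (@derive_val _ _ _ _ _ _ _ d0).
apply: eq_Rintegral => x _.
by rewrite /test' Y_shift0 ratio0 !mul1r mul0r addr0.
Qed.

Let intY : mu.-integrable setT (EFin \o Y).
Proof.
have zero_in : - s0 < 0 < s0 by rewrite oppr_lt0 s00.
apply: (@dominated K1) => // x; rewrite -Y_shift0.
by apply: le_trans (force_bound x zero_in) _; exact: ler_wpM2l.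
Qed.

Let intX : mu.-integrable setT (EFin \o X).
Proof.
apply: (@dominated (alpha * N + alpha * (8 / c))) => // x.
apply: le_trans (X_bound x) _; rewrite mulrDl; apply: lerD.
  apply: ler_peMr; first by rewrite mulr_ge0// ler0n.
  exact: le_trans (expS1 x) (expSW x).
rewrite -[leRHS]mulrA; apply: ler_wpM2l => //.
apply: le_trans (expS_S x) _; apply: ler_wpM2l => //.
by rewrite divr_ge0// ltW.
Qed.

Let XF x : F x = Y x - X x.
Proof. by rewrite /F /Y /X -sumrB; apply: eq_bigr => b _; rewrite -mulrBr. Qed.

Let intF : mu.-integrable setT (EFin \o F).
Proof.
rewrite (_ : EFin \o F = (EFin \o Y) \- (EFin \o X))%E; first exact: integrableB.
by apply/funext => x /=; rewrite XF EFinB.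
Qed.

Let int_mul (g k : T -> R) : mu.-integrable setT (EFin \o g) ->
  measurable_fun setT k -> (forall x, `|k x| <= 1) ->
  mu.-integrable setT (EFin \o (fun x => g x * k x)).
Proof.
move=> ig mk k1; have mg : measurable_fun setT g.
  by apply/measurable_EFinP; exact: measurable_int ig.
apply: (le_integrable measurableT _ _ ig).
  by apply/measurable_EFinP; exact: measurable_funM.
by move=> x _; rewrite /= lee_fin normrM ler_piMr.
Qed.

Let int_bounded (k : T -> R) : measurable_fun setT k -> (forall x, `|k x| <= 1) ->
  mu.-integrable setT (EFin \o k).
Proof.
move=> mk k1; apply: (@dominated 1) => // x; rewrite mul1r.
by apply: le_trans (k1 x) _; exact: le_trans (expS1 x) (expSW x).
Qed.

(** Translating along the test direction leaves the reference measure
    invariant; differentiating at 0 is an integration by parts. *)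
Lemma integration_by_parts t :
  \int[mu]_x (Y x * sin (t * X x)) = t * sigma2 * \int[mu]_x cos (t * X x).
Proof.
have iYs : mu.-integrable setT (EFin \o (fun x => Y x * sin (t * X x))).
  by apply: int_mul => //; exact: msin.
have ic : mu.-integrable setT (EFin \o (fun x => cos (t * X x))).
  by apply: int_bounded => //; exact: mcos.
(* the case [t = 0] removes the contribution of the term 1 of [test] *)
have Y0 : \int[mu]_x Y x = 0.
  have := test_stationary 0.
  under eq_Rintegral do rewrite !mul0r sin0 mulr0 !addr0 mulr1 -mulN1r.
  by rewrite RintegralZl// mulN1r => /eqP; rewrite oppr_eq0 => /eqP.
have := test_stationary t.
have -> : \int[mu]_x (- Y x * (1 + sin (t * X x)) + cos (t * X x) * (t * sigma2)) =
    \int[mu]_x (t * sigma2 * cos (t * X x) - (Y x + Y x * sin (t * X x))).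
  by apply: eq_Rintegral => x _; ring.
have iY2 : mu.-integrable setT (EFin \o (fun x => Y x + Y x * sin (t * X x))).
  rewrite (_ : EFin \o _ = (EFin \o Y) \+ (EFin \o (fun x => (Y x * sin (t * X x))%R)))%E.
    exact: integrableD.
  by apply/funext => x.
rewrite RintegralB//; last first.
  rewrite (_ : EFin \o _ = (fun x => (t * sigma2)%:E * (EFin \o (fun x => cos (t * X x)%R)) x)%E).
    exact: integrableZl.
  by apply/funext => x.
by rewrite RintegralZl// RintegralD// Y0 add0r => /eqP; rewrite subr_eq0 => /eqP.
Qed.

Lemma is_derive_cf (t : R) : is_derive t 1 (fun t => \int[mu]_x cos (t * X x))
  (- \int[mu]_x (X x * sin (t * X x))).
Proof.
rewrite -mulN1r -RintegralZl//; last by apply: int_mul => //; exact: msin.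
apply: (@is_derive_under_integral _ _ _ mu (fun t x => cos (t * X x))
  (fun t x => -1 * (X x * sin (t * X x))) (fun x => `|X x|) (t - 1) (t + 1)).
- by apply/andP; split; lra.
- by move=> s _; apply: int_bounded => //; exact: mcos.
- move=> s x _.
  have ds : is_derive s 1 (fun s => s * X x) (X x).
    have := is_derive_affine 0 (X x) s.
    by under [X in is_derive _ _ X _ -> _]eq_fun do rewrite add0r.
  have := @is_derive1_comp _ cos (fun s => s * X x) s _ _ (is_derive_cos _) ds.
  by rewrite mulN1r mulNr mulrC.
- exact: integrable_norm.
- by move=> s x _; rewrite mulN1r normrN normrM ler_piMr.
Qed.

(** The function [g t = E (cos (t * X)) * exp (t ^ 2 * sigma2 / 2)] is constant for
    a Gaussian field; here integration by parts shows that
    [g' t = E (F * sin (t * X)) * exp (t ^ 2 * sigma2 / 2)]. *)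
Lemma cf_error (lam t : R) : 0 < lam -> lam * alpha * l <= c / 8 ->
  `|\int[mu]_x cos (t * X x) - expR (- (t ^+ 2 / 2 * sigma2))| <=
  `|t| * anharmonic_error lam.
Proof.
move=> lam0 small.
set err := anharmonic_error lam.
have sg0 : 0 <= sigma2 by apply: sumr_ge0 => b _; exact: sqr_ge0.
pose g (t : R) := \int[mu]_x cos (t * X x) * expR (t ^+ 2 / 2 * sigma2).
pose g' (t : R) := \int[mu]_x (F x * sin (t * X x)) * expR (t ^+ 2 / 2 * sigma2).
have dg (z : R) : is_derive z 1 g (g' z).
  have dq : is_derive z 1 (fun z => z ^+ 2 / 2 * sigma2) (z * sigma2).
    have dq0 := @is_deriveX R R id 2 z 1 1 (@is_derive_id _ _ z 1).
    have := is_deriveZ (2^-1 * sigma2) dq0.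
    rewrite /GRing.scale/= mulr1 expr1 (_ : _ * _ * _ = z * sigma2); last by field.
    congr is_derive; apply/funext => r /=.
    by rewrite /GRing.scale/= mulrC mulrA.
  have de := @is_derive1_comp _ expR _ z _ _ (is_derive_expR _) dq.
  have := is_deriveM (is_derive_cf z) de.
  rewrite /GRing.scale/= => dM; apply: is_derive_eq dM _.
  rewrite /g'; under [in RHS]eq_Rintegral do rewrite XF mulrBl.
  rewrite RintegralB//; [|by apply: int_mul => //; exact: msin..].
  by rewrite integration_by_parts; ring.
have F_err (z : R) : `|\int[mu]_x (F x * sin (z * X x))| <= err.
  have iFs : mu.-integrable setT (EFin \o (fun x => F x * sin (z * X x))).
    by apply: int_mul => //; exact: msin.
  apply: le_trans (le_normr_Rintegral _ iFs) _ => //.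
  apply: (@le_trans _ _ (\int[mu]_x `|F x|)).
    apply: le_Rintegral => //; [exact: integrable_norm|exact: integrable_norm|].
    by move=> x _; rewrite normrM ler_piMr.
  rewrite -lee_fin /Rintegral fineK; first exact: anharmonic_moment.
  by apply: integrable_fin_num => //; exact: integrable_norm.
have g0 : g 0 = 1.
  rewrite /g expr0n/= !mul0r expR0 mulr1.
  under eq_Rintegral do rewrite mul0r cos0.
  by rewrite /Rintegral probability_integral_cst.
(* [g' z] is at most [err * exp (z ^ 2 * sigma2 / 2)], and [|z| <= |t|] *)
have [z [z1 z2 gt]] := mean_value 0 t dg.
rewrite g0 subr0 in gt.
have zt : z ^+ 2 <= t ^+ 2.
  case/orP: (le_total 0 t) => t0.
    rewrite (min_idPl t0) (max_idPr t0) in z1 z2.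
    by apply: lerXn2r; rewrite ?nnegrE.
  rewrite (min_idPr t0) (max_idPl t0) in z1 z2.
  rewrite -sqrrN -[leRHS]sqrrN; apply: lerXn2r; rewrite ?nnegrE ?oppr_ge0//.
  by rewrite lerN2.
rewrite -(@ler_pM2r _ (expR (t ^+ 2 / 2 * sigma2))) ?expR_gt0//.
rewrite -[X in _ * X <= _](gtr0_norm (expR_gt0 _)) -normrM mulrBl -expRD addNr expR0.
rewrite -/(g t) gt normrM [leLHS]mulrC -[leRHS]mulrA; apply: ler_wpM2l => //.
rewrite /g' normrM (gtr0_norm (expR_gt0 _)); apply: ler_pM => //; rewrite ?expR_ge0//.
by rewrite ler_expR ler_wpM2r// ler_wpM2r.
Qed.

Lemma integral_sin_eq0 (t : R) : \int[mu]_x sin (t * X x) = 0.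
Proof.
have is_ : mu.-integrable setT (EFin \o (fun x => sin (t * X x))).
  by apply: int_bounded => //; exact: msin.
have i1 : mu.-integrable setT (EFin \o cst (1 : R)).
  by apply: int_bounded => // x; rewrite normr1.
have lawE e : (\int[mu]_x (1 + sin (e * X x))%:E =
    \int[m]_x ((1 + sin (e * X x)) * p x)%:E)%E.
  rewrite law; first by apply: eq_integral => x _; rewrite EFinM.
  - by apply/measurable_EFinP; apply: measurable_funD => //; exact: msin.
  - by move=> x; rewrite lee_fin; have := sin_geN1 (e * X x); lra.
have sym : \int[mu]_x (1 + sin (t * X x)) = \int[mu]_x (1 - sin (t * X x)).
  under [RHS]eq_Rintegral do rewrite -sinN -mulNr.
  rewrite /Rintegral; congr fine; rewrite !lawE.
  rewrite -(@neg_inv (fun x => ((1 + sin (- t * X x)) * p x)%:E)).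
  - apply: eq_integral => x _; congr (_ * _)%:E.
      rewrite (_ : X (neg x) = - X x) ?mulrNN//.
      by rewrite /X -sumrN; apply: eq_bigr => b _; rewrite A_neg mulrN.
    rewrite /p; congr (_ * expR (- _)).
    by apply: eq_bigr => b _; rewrite A_neg h_even.
  - apply/measurable_EFinP; apply: measurable_funM => //.
    by apply: measurable_funD => //; exact: msin.
  - by move=> x; rewrite lee_fin mulr_ge0 ?(ltW (p0 x)).
by move: sym; rewrite RintegralD// RintegralB// => ?; lra.
Qed.

End characteristic_function.

End gibbs_estimates.
(** * Lattice cells and Riemann sums *)

Section boxes.
Context {R : realType}.
Local Notation Rm := (measurableTypeR R).

Definition box n (a b : 'I_n -> R) : set (n.-tuple Rm) :=
  [set x | forall i, a i <= tnth x i < b i].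

Lemma measurable_box n (a b : 'I_n -> R) : measurable (box a b).
Proof.
rewrite (_ : box a b = \bigcap_(i in [set: 'I_n])
    ((fun x : n.-tuple Rm => tnth x i) @^-1` `[a i, b i[%classic)).
  apply: fin_bigcap_measurable; first exact: finite_finset.
  by move=> i _; rewrite -[X in measurable X]setTI; exact: measurable_tnth.
apply/seteqP; split => x.
  by move=> abx i _ /=; rewrite in_itv/=; exact: abx.
by move=> abx i; have := abx i I; rewrite /= in_itv.
Qed.

Lemma lebesgue_measure_box n (a b : 'I_n -> R) : (forall i, a i <= b i) ->
  lebesgue_measure_tuple n (box a b) = (\prod_(i < n) (b i - a i))%:E.
Proof.
rewrite /lebesgue_measure_tuple; elim: n a b => [|n IH] a b ab.
  by rewrite big_ord0 /= diracE mem_set// => -[].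
rewrite big_ord_recl /= /cons_measure /pushforward.
rewrite (_ : _ @^-1` _ = `[a ord0, b ord0[%classic `*`
    box (a \o lift ord0) (b \o lift ord0)); last first.
  apply/seteqP; split => -[x t] /=.
    move=> h; split => [|i]; first by have := h ord0; rewrite tnth0 in_itv.
    by have := h (lift ord0 i); rewrite tnthS.
  rewrite in_itv/= => -[h0 h] i.
  by case: (unliftP ord0 i) => [j|] ->; rewrite ?tnthS ?tnth0//; exact: h.
rewrite product_measure1E//; last exact: measurable_box.
rewrite [X in (X * _)%E](lebesgue_measure_itv `[a ord0, b ord0[%R)/= lte_fin.
rewrite [X in (_ * X)%E]IH; last by move=> i; exact: ab.
have := ab ord0; rewrite le_eqVlt => /orP[/eqP ->|->].
  by rewrite ltxx subrr mul0r mul0e.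
by rewrite -EFinB -EFinM.
Qed.

End boxes.

Section cells.
Context {R : realType} {d : nat}.
Local Notation Rm := (measurableTypeR R).
Local Notation leb := (lebesgue_measure_tuple d :
  {sigma_finite_measure set (d.-tuple Rm) -> \bar R}).
Implicit Types (eps : R) (k : 'rV[int]_d) (D : set 'rV[R]_d).

Definition point (x : d.-tuple Rm) : 'rV[R]_d := \row_i tnth x i.

Definition cell eps k : set (d.-tuple Rm) :=
  box (fun i => eps * (k 0 i)%:~R) (fun i => eps * (k 0 i)%:~R + eps).

Definition cell_of eps (x : d.-tuple Rm) : 'rV[int]_d :=
  \row_i Num.floor (tnth x i / eps).

Lemma in_cell eps k x : 0 < eps -> cell eps k x <-> cell_of eps x = k.
Proof.
move=> e0; split => [kx|<- i].
  apply/rowP => i; rewrite mxE; apply/eqP; rewrite floor_eq.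
  have /andP[k1 k2] := kx i.
  by rewrite ler_pdivlMr// mulrC k1 ltr_pdivrMr// intrD mulrDl mul1r mulrC.
rewrite !mxE; have /andP[f1 f2] := floor_itv (tnth x i / eps).
move: f1 f2; rewrite ler_pdivlMr// ltr_pdivrMr// intrD mulrDl mul1r.
by rewrite [eps * _]mulrC => -> ->.
Qed.

Lemma measurable_cell eps k : measurable (cell eps k).
Proof. exact: measurable_box. Qed.

Lemma volume_cell eps k : 0 < eps -> leb (cell eps k) = (eps ^+ d)%:E.
Proof.
move=> e0; rewrite lebesgue_measure_box => [|i]; last by rewrite lerDl ltW.
under eq_bigr do rewrite addrC addKr.
by rewrite prodr_const card_ord.
Qed.

Lemma cell_ball eps k x (r : R) : 0 < eps < r -> cell eps k x ->
  ball (point x) r (site_point eps k).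
Proof.
move=> /andP[e0 er] kx; split; first exact: lt_trans er.
move=> i j; rewrite (ord1 i) !mxE.
have /andP[k1 k2] := kx j; rewrite /ball/= ger0_norm ?subr_ge0//.
by apply: lt_trans er; rewrite ltrBlDr addrC.
Qed.

(** The points of the lattice of mesh [1 / n.+1] nearest below [x] converge to
    [x], and a function of the lattice cell is measurable because there are
    countably many cells. *)
Lemma measurable_continuous_point (f : 'rV[R]_d -> R) : continuous f ->
  measurable_fun setT (f \o point).
Proof.
move=> cf; pose e n : R := n.+1%:R^-1.
have e0 n : 0 < e n by rewrite invr_gt0.
apply: (@measurable_fun_cvg _ _ _ _ (fun n x => f (site_point (e n) (cell_of (e n) x)))).
  move=> n _ B mB; rewrite setTI.
  rewrite (_ : _ @^-1` B = \bigcup_(k : 'rV[int]_d)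
      (if `[< B (f (site_point (e n) k)) >] then cell (e n) k else set0)).
    apply: countable_bigcupT_measurable => [|k]; first exact: countableP.
    by case: ifP => _; [exact: measurable_cell|exact: measurable0].
  apply/seteqP; split => x /=.
    move=> Bx; exists (cell_of (e n) x) => //; rewrite ifT; first exact/in_cell.
    exact/asboolP.
  by move=> [k _]; case: ifP => // /asboolP Bk /(in_cell _ _ (e0 n)) ->.
move=> x _.
suff cvgx : site_point (e n) (cell_of (e n) x) @[n --> \oo] --> point x.
  exact: (cvg_comp _ _ cvgx (cf (point x))).
apply/cvg_ballP => r r0.
have e_cvg : e n @[n --> \oo] --> (0 : R) by exact: cvg_harmonic.
near=> n; apply: cell_ball; last exact/in_cell.
rewrite e0/=; near: n.
have /cvgrPdist_lt/(_ r r0) := e_cvg.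
by apply: filterS => n; rewrite sub0r normrN ger0_norm// ltW.
Unshelve. all: by end_near. Qed.

End cells.

Section sites.
Context {R : realType} {d : nat}.
Local Notation Rm := (measurableTypeR R).
Local Notation leb := (lebesgue_measure_tuple d :
  {sigma_finite_measure set (d.-tuple Rm) -> \bar R}).
Implicit Types (eps : R) (k : 'rV[int]_d) (D : set 'rV[R]_d).

Lemma ler_coord_norm (x : 'rV[R]_d) i : `|x 0 i| <= `|x|.
Proof.
rewrite [leRHS](mx_normrE x).
exact: (le_bigmax _ (fun ij : 'I_1 * 'I_d => `|x ij.1 ij.2|) (0, i)).
Qed.

Lemma bounded_coordinates D : bounded_set D ->
  exists2 M : R, 0 < M & forall x, D x -> forall i, `|x 0 i| <= M.
Proof.
move=> [M [_ bM]]; exists (Num.max M 0 + 1); first by rewrite ltr_wpDl// le_max lexx orbT.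
move=> x Dx i; apply: le_trans (ler_coord_norm x i) _.
by apply: bM => //; rewrite ltr_pwDr// le_max lexx.
Qed.

Lemma finite_lattice_domain D eps : 0 < eps -> bounded_set D ->
  finite_set (lattice_domain D eps).
Proof.
move=> e0 /bounded_coordinates[M M0 DM].
(* the coordinates of the sites lie between [- m] and [m] *)
pose m := (Num.trunc (M / eps)).+1.
pose f (v : 'rV['I_(m + m).+1]_d) : 'rV[int]_d := \row_i ((v 0 i)%:Z - m%:Z).
apply: (@sub_finite_set _ _ (f @` setT)); last exact/finite_image/finite_finset.
move=> k Dk; exists (\row_i inord (absz (k 0 i + m%:Z))) => //.
apply/rowP => i; rewrite !mxE.
have km : `|k 0 i| <= m%:Z.
  rewrite -(ler_int R) intr_norm.
  have := DM _ Dk i; rewrite mxE normrM (gtr0_norm e0) mulrC -ler_pdivlMr// => /le_trans; apply.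
  by rewrite ltW// truncnS_gt// divr_ge0// ltW.
move: km; rewrite ler_norml => /andP[k1 k2].
have k0 : 0 <= k 0 i + m%:Z by rewrite -lerBlDr sub0r.
rewrite inordK; first by rewrite gez0_abs// addrK.
by rewrite ltnS -lez_nat gez0_abs// PoszD lerD2r.
Qed.

Lemma mem_sites D eps k : 0 < eps -> bounded_set D ->
  (k \in sites D eps) <-> lattice_domain D eps k.
Proof.
move=> e0 bD; rewrite /sites in_fset_set ?inE//.
exact: finite_lattice_domain.
Qed.

Lemma uniq_sites D eps : uniq (sites D eps).
Proof. exact: fset_uniq. Qed.

Lemma sum_cells eps (s : seq 'rV[int]_d) (g : 'rV[int]_d -> R) x :
  0 < eps -> uniq s ->
  \sum_(k <- s) g k * \1_(cell eps k) x =
  if cell_of eps x \in s then g (cell_of eps x) else 0.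
Proof.
move=> e0 us.
have cellE k : \1_(cell eps k) x = (cell_of eps x == k)%:R :> R.
  rewrite indicE; congr ((nat_of_bool _)%:R); apply/idP/eqP => [|xk].
    by rewrite inE => /(in_cell _ _ e0).
  by rewrite inE; exact/in_cell.
under eq_bigr do rewrite cellE.
case: ifPn => xs.
  rewrite (bigD1_seq _ xs us)/= eqxx mulr1 big1 ?addr0// => k kx.
  by rewrite eq_sym (negbTE kx) mulr0.
rewrite big1_seq// => k /andP[_ ks].
by case: eqP => [xk|]; rewrite ?mulr0//; rewrite xk ks in xs.
Qed.

Lemma integral_step eps (s : seq 'rV[int]_d) (g : 'rV[int]_d -> R) : 0 < eps ->
  (forall k, 0 <= g k) ->
  (\int[leb]_x (\sum_(k <- s) g k * \1_(cell eps k) x)%:E =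
   (\sum_(k <- s) g k * eps ^+ d)%:E)%E.
Proof.
move=> e0 g0; under eq_integral do rewrite -sumEFin.
have m1 k : measurable_fun setT (fun x : d.-tuple Rm => (\1_(cell eps k) x : R)).
  by apply: measurable_indic; exact: measurable_cell.
rewrite ge0_integral_sum//.
- rewrite -sumEFin; apply: eq_bigr => k _.
  under eq_integral do rewrite EFinM.
  rewrite ge0_integralZl_EFin//.
  + rewrite integral_indic//; last exact: measurable_cell.
    by rewrite setIT EFinM; congr (_ * _)%E; exact: volume_cell.
  + exact/measurable_EFinP.
- by move=> k; apply/measurable_EFinP; exact: measurable_funM.
- by move=> k x _; rewrite lee_fin mulr_ge0.
Qed.

Lemma riemann_sum eps (s : seq 'rV[int]_d) (g : 'rV[int]_d -> R)
    (G : d.-tuple Rm -> R) (delta : R) :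
  0 < eps -> uniq s -> (forall k, 0 <= g k) -> 0 <= delta ->
  measurable_fun setT G -> (forall x, 0 <= G x) ->
  (forall x, cell_of eps x \notin s -> G x = 0) ->
  (forall x, cell_of eps x \in s -> `|G x - g (cell_of eps x)| <= delta) ->
  `|\int[leb]_x G x - \sum_(k <- s) g k * eps ^+ d| <=
  delta * ((size s)%:R * eps ^+ d).
Proof.
move=> e0 us g0 delta0 mG G0 Gout Gin.
pose step (f : 'rV[int]_d -> R) x := \sum_(k <- s) f k * \1_(cell eps k) x.
have mstep f : measurable_fun setT (step f).
  apply: measurable_sum => k; apply: measurable_funM => //.
  by apply: measurable_indic; exact: measurable_cell.
have step0 f x : (forall k, 0 <= f k) -> 0 <= step f x.
  by move=> f0; apply: sumr_ge0 => k _; exact: mulr_ge0.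
have sum_const : \sum_(k <- s) delta * eps ^+ d = delta * ((size s)%:R * eps ^+ d).
  rewrite -mulr_sumr -sum1_size natr_sum mulr_suml; congr (_ * _).
  by apply: eq_bigr => k _; rewrite mul1r.
have upper : (\int[leb]_x (G x)%:E <=
    (\sum_(k <- s) g k * eps ^+ d + delta * ((size s)%:R * eps ^+ d))%:E)%E.
  rewrite -sum_const -big_split/=.
  have -> : \sum_(k <- s) (g k * eps ^+ d + delta * eps ^+ d) =
      \sum_(k <- s) (g k + delta) * eps ^+ d.
    by apply: eq_bigr => k _; rewrite mulrDl.
  rewrite -(@integral_step eps _ _ e0); last by move=> k; exact: addr_ge0.
  apply: ge0_le_integral => //.
  - by move=> x _; rewrite lee_fin.
  - exact/measurable_EFinP.
  - by apply/measurable_EFinP; exact: (mstep (fun k => g k + delta)).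
  move=> x _; rewrite lee_fin sum_cells//; case: ifPn => [/Gin|/Gout ->//].
  by move=> /(le_trans (ler_norm _)); lra.
have lower : ((\sum_(k <- s) g k * eps ^+ d)%:E <=
    \int[leb]_x (G x)%:E + (delta * ((size s)%:R * eps ^+ d))%:E)%E.
  rewrite -sum_const -!(@integral_step eps _ _ e0)//.
  rewrite -ge0_integralD//; first last.
  - by apply/measurable_EFinP; exact: (mstep (cst delta)).
  - by move=> x _; rewrite lee_fin (step0 (cst delta)).
  - exact/measurable_EFinP.
  - by move=> x _; rewrite lee_fin.
  apply: ge0_le_integral => //.
  - by move=> x _; rewrite lee_fin step0.
  - by apply/measurable_EFinP; exact: (mstep g).
  - by apply: emeasurable_funD; apply/measurable_EFinP => //; exact: (mstep (cst delta)).
  move=> x _; rewrite -EFinD lee_fin !sum_cells//.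
  case: ifPn => [/Gin|/Gout ->]; last by rewrite addr0.
  by rewrite distrC => /(le_trans (ler_norm _)); lra.
have Gfin : (\int[leb]_x (G x)%:E)%E \is a fin_num.
  rewrite ge0_fin_numE; first by apply: le_lt_trans upper _; rewrite ltry.
  by apply: integral_ge0 => x _; rewrite lee_fin.
move: upper lower; rewrite -(fineK Gfin) -EFinD !lee_fin -/(Rintegral _ _ _) => up lo.
by rewrite ler_norml; apply/andP; split; lra.
Qed.

(** The cells of the sites are disjoint and lie in a fixed box. *)
Lemma sites_volume D : bounded_set D ->
  exists2 C : R, 0 < C & forall eps, 0 < eps <= 1 ->
    (size (sites D eps))%:R * eps ^+ d <= C.
Proof.
move=> bD; have [M M0 DM] := bounded_coordinates bD.
exists ((2 * M + 1) ^+ d); first by rewrite exprn_gt0// addr_gt0// mulr_gt0.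
move=> eps /andP[e0 e1].
pose B := box (fun _ : 'I_d => - M) (fun _ => M + 1).
have volB : (\int[leb]_x (\1_B x)%:E = ((2 * M + 1) ^+ d)%:E)%E.
  rewrite integral_indic//; last exact: measurable_box.
  rewrite setIT; transitivity ((\prod_(i < d) (M + 1 - - M))%:E).
    by apply: lebesgue_measure_box => i; lra.
  by rewrite prodr_const card_ord; congr ((_ ^+ d)%:E); ring.
rewrite -lee_fin -volB.
have -> : (size (sites D eps))%:R * eps ^+ d =
    \sum_(k <- sites D eps) 1 * eps ^+ d.
  by rewrite -mulr_suml -sum1_size natr_sum.
rewrite -(@integral_step eps _ _ e0)//; apply: ge0_le_integral => //.
- by move=> x _; rewrite lee_fin sumr_ge0// => k _; rewrite mulr_ge0.
- apply/measurable_EFinP; apply: measurable_sum => k; apply: measurable_funM => //.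
  by apply: measurable_indic; exact: measurable_cell.
- by apply/measurable_EFinP/measurable_indic; exact: measurable_box.
move=> x _; rewrite lee_fin (@sum_cells eps _ _ _ e0 (uniq_sites _ _)); case: ifP => // xs.
rewrite indicE mem_set// => i.
have xc : cell eps (cell_of eps x) x by exact/in_cell.
move/(mem_sites _ e0 bD): xs => /DM/(_ i).
rewrite mxE ler_norml => /andP[x1 x2]; have /andP[x3 x4] := xc i.
by apply/andP; split; lra.
Qed.

End sites.
(** * Test functions on the lattice *)

Section edge_sums.
Context {R : realType} {d : nat}.
Implicit Types (eps : R) (k : 'rV[int]_d) (D : set 'rV[R]_d).

Lemma shift_site_inj k : injective (fun i : 'I_d => k + delta_mx 0 i).
Proof.
move=> i j /addrI /rowP /(_ i); rewrite !mxE !eqxx/=.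
by case: eqP.
Qed.

Lemma sum_oriented_edges D eps (f : 'rV[int]_d * 'rV[int]_d -> R) :
  \sum_(b <- oriented_edges D eps) f b =
  \sum_(k <- sites D eps) \sum_(i < d)
    if k + delta_mx 0 i \in sites D eps then f (k, k + delta_mx 0 i) else 0.
Proof.
rewrite /oriented_edges big_filter big_mkcond big_allpairs.
apply: eq_bigr => k _.
transitivity (\sum_(l <- sites D eps) \sum_(i < d)
    if l == k + delta_mx 0 i then f (k, l) else 0).
  apply: eq_bigr => l _ /=; case: existsP => [[i /eqP ->]|no].
    rewrite (bigD1 i)//= eqxx big1 ?addr0// => j ji.
    by rewrite ifF//; apply/negbTE; apply: contraNneq ji => /shift_site_inj ->.
  by rewrite big1// => i _; case: ifP => // e; case: no; exists i.
rewrite exchange_big/=; apply: eq_bigr => i _.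
case: ifPn => ks.
  rewrite (bigD1_seq _ ks (uniq_sites _ _))/= eqxx big1 ?addr0// => l lk.
  by rewrite (negbTE lk).
rewrite big1_seq// => l /andP[_ ls]; rewrite ifF//.
by apply: contraNF ks => /eqP <-.
Qed.

Lemma site_point_shift eps k i :
  site_point eps (k + delta_mx 0 i) = site_point eps k + eps *: delta_mx 0 i.
Proof.
apply/rowP => j; rewrite !mxE eqxx/= intrD mulrDr.
by case: (j == i); rewrite ?mulr0 ?mulr1.
Qed.

End edge_sums.

Section test_functions.
Context {R : realType} {d : nat}.
Implicit Types (eps : R) (k : 'rV[int]_d).
Variables (D : set 'rV[R]_d) (phi : 'rV[R]_d -> R).
Hypotheses (oD : open D) (tphi : test_function D phi).
Local Notation Rm := (measurableTypeR R).
Local Notation leb := (lebesgue_measure_tuple d :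
  {sigma_finite_measure set (d.-tuple Rm) -> \bar R}).

Let supp := closure [set x | phi x != 0].

Let csupp : compact supp. Proof. by case: tphi. Qed.
Let suppD : supp `<=` D. Proof. by case: tphi. Qed.

Let derivable_partial i x : derivable phi x (delta_mx 0 i).
Proof. by case: tphi => /(_ 1%N)[_ /(_ i)[+ _]] _ _; exact. Qed.

Let continuous_partial i : continuous (partial i phi).
Proof. by case: tphi => /(_ 1%N)[_ /(_ i)[_ [+ _]]] _ _. Qed.

Let phi_out x : ~ supp x -> phi x = 0.
Proof.
by move=> sx; apply/eqP; apply: contra_notT sx => phix; exact: subset_closure.
Qed.

Let partial_out i x : ~ supp x -> partial i phi x = 0.
Proof.
move=> sx; have : \forall y \near x, phi y = cst 0 y.
  have : nbhs x (~` supp).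
    by apply: open_nbhs_nbhs; split => //; exact/closed_openC/closed_closure.
  by apply: filterS => y; exact: phi_out.
by move=> /near_eq_derive; rewrite /partial => ->; rewrite derive_cst.
Qed.

(* Compactness turns a property holding locally, at scales that may depend on the
   point, into one holding at a common scale on the whole support. *)
Let near_support (P : R -> 'rV[R]_d -> Prop) :
  (forall x, supp x -> exists2 e : R, 0 < e &
     forall y r, ball x e y -> 0 < r < e -> P r y) ->
  \forall r \near 0^'+, forall x, supp x -> P r x.
Proof.
move=> H; have := (@compact_near_coveringP _ supp).1 csupp R (0^'+) P _.
apply => x /H[e e0 He].
exists (ball x e, [set r | 0 < r < e]).
  split => /=; first exact: nbhsx_ballx.
  near=> r; apply/andP; split; near: r; [exact: nbhs_right_gt|exact: nbhs_right_lt].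
by move=> [y r]/= [xy re]; exact: He.
Unshelve. all: by end_near. Qed.

Lemma support_margin :
  \forall r \near 0^'+, forall x, supp x -> forall y, ball x r y -> D y.
Proof.
apply: near_support => x /suppD Dx.
have /nbhs_ballP[e /= e0 He] : nbhs x D by exact: open_nbhs_nbhs.
exists (e / 2); first by rewrite divr_gt0.
move=> y r xy /andP[r0 re] z yz; apply: He.
by apply: (@ball_split _ _ y) => //; apply: le_ball yz; exact: ltW.
Qed.

(** Heine's theorem near the support; away from it the partial derivatives
    vanish, and a pair with one point in the support is handled by symmetry. *)
Lemma partial_uniformly_continuous i (delta : R) : 0 < delta ->
  \forall r \near 0^'+, forall x y, ball x r y ->
    `|partial i phi x ^+ 2 - partial i phi y ^+ 2| <= delta.
Proof.
move=> delta0; pose q x := partial i phi x ^+ 2.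
have cq : continuous q.
  rewrite (_ : q = fun x => partial i phi x * partial i phi x).
    by move=> x; apply: continuousM; exact: continuous_partial.
  by apply/funext => x; rewrite /q expr2.
have : \forall r \near 0^'+, forall x, supp x -> forall y, ball x r y ->
    `|q x - q y| <= delta.
  apply: near_support => x _.
  have : \forall y \near x, `|q x - q y| < delta / 2.
    by have /cvgrPdist_lt := cq x; apply; rewrite divr_gt0.
  move=> /nbhs_ballP[e /= e0 He]; exists (e / 2); first by rewrite divr_gt0.
  move=> y r xy /andP[r0 re] z yz.
  have h1 : `|q x - q y| < delta / 2.
    by apply: He; apply: le_ball xy; rewrite ler_pdivrMr// ler_pMr// ler1n.
  have h2 : `|q x - q z| < delta / 2.
    by apply: He; apply: (@ball_split _ _ y) => //; apply: le_ball yz; exact: ltW.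
  rewrite (_ : q y - q z = (q x - q z) - (q x - q y)); last by ring.
  by apply: le_trans (ler_normB _ _) _; lra.
apply: filterS => r H x y xy.
have [sx|sx] := pselect (supp x); first exact: H.
have [sy|sy] := pselect (supp y).
  by rewrite distrC; apply: H => //; exact: ball_sym.
by rewrite !partial_out// subrr normr0 ltW.
Qed.

Lemma partial_bounded : exists2 B : R, 0 <= B & forall i x, `|partial i phi x| <= B.
Proof.
have bound i : exists2 B : R, 0 <= B & forall x, `|partial i phi x| <= B.
  have : bounded_set (partial i phi @` supp).
    apply: compact_bounded; apply: continuous_compact => //.
    by apply: continuous_subspaceT; exact: continuous_partial.
  move=> [M [_ bM]]; exists (Num.max M 0 + 1).
    by rewrite addr_ge0// le_max lexx orbT.
  move=> x; have [sx|sx] := pselect (supp x).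
    by apply: bM; [rewrite ltr_pwDr// le_max lexx|exists x].
  by rewrite partial_out// normr0 addr_ge0// le_max lexx orbT.
pose B i := sval (cid2 (bound i)).
have B0 i : 0 <= B i by rewrite /B; case: cid2.
exists (\sum_i B i); first by apply: sumr_ge0.
move=> i x; rewrite (bigD1 i)//=; apply: (@le_trans _ _ (B i)).
  by rewrite /B; case: cid2.
by rewrite lerDl sumr_ge0.
Qed.

Lemma difference_quotient i x (s : R) : 0 < s -> exists2 r : R, 0 <= r <= s &
  phi (x + s *: delta_mx 0 i) - phi x = partial i phi (x + r *: delta_mx 0 i) * s.
Proof.
move=> s0; pose f r := phi (x + r *: delta_mx 0 i).
have df (r : R) : is_derive r 1 f (partial i phi (x + r *: delta_mx 0 i)).
  have fE : (fun h : R => h^-1 *: ((f \o shift r) (h *: 1) - f r)) =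
    (fun h => h^-1 *: ((phi \o shift (x + r *: delta_mx 0 i))
      (h *: delta_mx 0 i) - phi (x + r *: delta_mx 0 i))).
    apply/funext => h /=; rewrite /f; congr (_ *: (phi _ - _)).
    by rewrite (_ : h *: (1 : R) = h) ?[LHS]mulr1// scalerDl addrCA.
  have dp := @derivable_partial i (x + r *: delta_mx 0 i).
  by apply: DeriveDef; [rewrite /derivable fE|rewrite /partial /derive fE].
have [r [r1 r2 fr]] := mean_value 0 s df.
rewrite (min_idPl (ltW s0)) (max_idPr (ltW s0)) in r1 r2.
exists r; first by rewrite r1.
by move: fr; rewrite /f scale0r addr0 subr0.
Qed.

Definition difference_energy eps k :=
  \sum_(i < d) ((phi (site_point eps (k + delta_mx 0 i)) - phi (site_point eps k)) / eps) ^+ 2.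

Definition coefficient eps (b : 'rV[int]_d * 'rV[int]_d) :=
  eps `^ (d%:R / 2 - 1) * (phi (site_point eps b.2) - phi (site_point eps b.1)).

(** Each term of the edge sum is thus a squared difference quotient times the
    volume [eps ^ d] of a cell. *)
Lemma powR_scaling eps : 0 < eps -> (eps `^ (d%:R / 2 - 1) * eps) ^+ 2 = eps ^+ d.
Proof.
move=> e0; rewrite -[X in (_ * X) ^+ 2](powRr1 (ltW e0)) -powRD; last first.
  by rewrite (gt_eqF e0) implybT.
rewrite subrK -powR_mulrn ?powR_ge0// -powRrM divfK//.
by rewrite powR_mulrn// ltW.
Qed.

(** An edge leaving the lattice domain contributes nothing: both its endpoints are
    outside the support once [2 * eps] is below the distance from the support to the
    complement of [D]. *)
Lemma coefficient_energy eps : 0 < eps -> bounded_set D ->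
  (forall x, supp x -> forall y, ball x (2 * eps) y -> D y) ->
  \sum_(b <- oriented_edges D eps) coefficient eps b ^+ 2 =
  \sum_(k <- sites D eps) difference_energy eps k * eps ^+ d.
Proof.
move=> e0 bD margin; rewrite sum_oriented_edges; apply: eq_bigr => k _.
rewrite /difference_energy mulr_suml; apply: eq_bigr => i _.
have scal u : (eps `^ (d%:R / 2 - 1) * u) ^+ 2 = (u / eps) ^+ 2 * eps ^+ d.
  by rewrite -(powR_scaling e0) -exprMn; congr (_ ^+ 2); field; rewrite gt_eqF.
case: ifPn => ks; first by rewrite /coefficient scal.
have Dk : ~ D (site_point eps (k + delta_mx 0 i)).
  by move=> Dk; move/negP: ks; apply; exact/mem_sites.
rewrite (phi_out (fun s => Dk (suppD s))) phi_out ?subrr ?mul0r ?expr0n ?mul0r//.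
move=> sk; apply: Dk; apply: margin sk _ _.
split; first by rewrite mulr_gt0.
move=> a j; rewrite site_point_shift !mxE (ord1 a) /ball/= opprD addNKr normrN normrM gtr0_norm//.
by case: (j == i); rewrite ?normr1 ?normr0 ?mulr1 ?mulr0; lra.
Qed.

(** By the mean value theorem the difference quotients are values of the partial
    derivatives at points of the same cell, up to its closure. *)
Lemma energy_convergence : bounded_set D ->
  \sum_(b <- oriented_edges D eps) coefficient eps b ^+ 2 @[eps --> 0^'+] -->
  dirichlet_energy D phi.
Proof.
move=> bD; have [C C0 volC] := sites_volume bD.
pose G (x : d.-tuple Rm) := \sum_(i < d) partial i phi (point x) ^+ 2.
have energyE : dirichlet_energy D phi = \int[leb]_x G x.
  rewrite /dirichlet_energy Rintegral_mkcond; apply: eq_Rintegral => x _.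
  rewrite patchE; case: ifPn => // xD.
  rewrite /G big1// => i _; rewrite partial_out ?expr0n// => /suppD Dx.
  by move/negP: xD; apply; rewrite inE.
have mG : measurable_fun setT G.
  apply: measurable_sum => i; apply: measurable_funX.
  exact: (measurable_continuous_point (@continuous_partial i)).
have G0 x : 0 <= G x by apply: sumr_ge0 => i _; exact: sqr_ge0.
rewrite energyE; apply/cvgrPdist_le => e e0.
pose delta := e / (C * (d%:R + 1)).
have d1 : 0 < d%:R + 1 :> R by rewrite ltr_wpDl.
have delta0 : 0 < delta by rewrite divr_gt0// mulr_gt0.
have [rho [rho0 rhoD rhoq]] : exists rho : R, [/\ 0 < rho,
    forall x, supp x -> forall y, ball x rho y -> D y &
    forall i x y, ball x rho y ->
      `|partial i phi x ^+ 2 - partial i phi y ^+ 2| <= delta].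
  near (0 : R)^'+ => r; exists r; split; near: r.
  - exact: nbhs_right_gt.
  - exact: support_margin.
  - by apply: filter_forall => i; exact: partial_uniformly_continuous.
near=> eps.
have eps0 : 0 < eps by near: eps; exact: nbhs_right_gt.
have eps1 : eps <= 1 by near: eps; exact: nbhs_right_le.
have epsr : eps < rho / 2 by near: eps; apply: nbhs_right_lt; rewrite divr_gt0.
have epsrho : 0 < eps < rho by rewrite eps0/=; lra.
rewrite coefficient_energy//; last first.
  by move=> x sx y xy; apply: rhoD sx _ _; apply: le_ball xy; lra.
apply: (@le_trans _ _ (d%:R * delta * ((size (sites D eps))%:R * eps ^+ d))).
  apply: riemann_sum => //; first exact: uniq_sites.
  - by move=> k; apply: sumr_ge0 => i _; exact: sqr_ge0.
  - by rewrite mulr_ge0// ltW.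
  - move=> x xs; rewrite /G big1// => i _; rewrite partial_out ?expr0n// => sx.
    move/negP: xs; apply; apply/(mem_sites _ eps0 bD); apply: rhoD sx _ _.
    by apply: cell_ball => //; exact/in_cell.
  - move=> x _; rewrite /G /difference_energy -sumrB.
    apply: le_trans (ler_norm_sum _ _ _) _.
    apply: (@le_trans _ _ (\sum_(i < d) delta)); last by rewrite sumr_const card_ord mulr_natl.
    apply: ler_sum => i _; rewrite site_point_shift.
    have [r /andP[r0 r1] ->] := difference_quotient i (site_point eps (cell_of eps x)) eps0.
    rewrite mulfK ?gt_eqF//; apply: rhoq; split => // a j.
    have /andP[k1 k2] : eps * (cell_of eps x 0 j)%:~R <= tnth x j <
      eps * (cell_of eps x 0 j)%:~R + eps by have /in_cell := erefl (cell_of eps x); exact.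
    rewrite !mxE (ord1 a) eqxx/= /ball/=; rewrite !mxE in k1 k2.
    have : 0 <= r * (j == i)%:R <= eps.
      by case: (j == i); rewrite ?mulr1 ?mulr0 ?r0 ?lexx//= ltW.
    move=> /andP[u1 u2]; rewrite ltr_norml; apply/andP; split; lra.
apply: (@le_trans _ _ (d%:R * delta * C)).
  by apply: ler_wpM2l; [rewrite mulr_ge0// ltW|apply: volC; rewrite eps0].
rewrite /delta (_ : _ * C = e * (d%:R / (d%:R + 1))); last first.
  by field; rewrite !gt_eqF.
rewrite ler_piMr ?(ltW e0)// ler_pdivrMr// mul1r lerDl//.
Unshelve. all: by end_near. Qed.

Lemma coefficient_bound : exists2 B : R, 0 < B &
  forall eps, 0 < eps -> forall b, b \in oriented_edges D eps ->
    `|coefficient eps b| <= eps `^ (d%:R / 2 - 1) * eps * B.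
Proof.
have [B B0 bB] := partial_bounded; exists (B + 1); first by rewrite ltr_wpDl.
move=> eps e0 [k l]; rewrite mem_filter => /andP[/existsP[i /eqP /= ->] _].
rewrite /coefficient/= site_point_shift normrM ger0_norm ?powR_ge0//.
have [r _ ->] := difference_quotient i (site_point eps k) e0.
rewrite -[leRHS]mulrA; apply: ler_wpM2l; first exact: powR_ge0.
rewrite normrM (gtr0_norm e0) mulrC; apply: ler_wpM2l; first exact: ltW.
by apply: le_trans (bB _ _) _; rewrite lerDl.
Qed.

Lemma test_function_boundary : \forall eps \near 0^'+,
  forall k, lattice_boundary D eps k -> phi (site_point eps k) = 0.
Proof.
have [rho [rho0 rhoD]] : exists rho : R, 0 < rho /\
    forall x, supp x -> forall y, ball x rho y -> D y.
  near (0 : R)^'+ => r; exists r; split; near: r.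
  - exact: nbhs_right_gt.
  - exact: support_margin.
near=> eps => k [_ [l kl nDl]]; apply: phi_out => sk; apply: nDl.
have eps0 : 0 < eps by near: eps; exact: nbhs_right_gt.
have epsr : eps < rho by near: eps; exact: nbhs_right_lt.
apply: rhoD sk _ _; split => // a j; rewrite !mxE /ball/= -mulrBr normrM gtr0_norm//.
apply: le_lt_trans epsr; rewrite ler_piMr ?(ltW eps0)//.
rewrite -intrB -intr_norm -[leRHS]/(1%:~R) ler_int.
move/eqP: kl => <-; rewrite (bigD1 j)//= lerDl.
by apply: sumr_ge0.
Unshelve. all: by end_near. Qed.

End test_functions.
(** * Integration against a density *)

Section density.
Local Open Scope ereal_scope.
Context {R : realType} {dT : measure_display} {T : measurableType dT}.
Variables (m nu : {measure set T -> \bar R}) (p : T -> R).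
Hypotheses (mp : measurable_fun setT p) (p0 : forall x, (0 <= p x)%R).
Hypothesis nuE : forall A, measurable A -> nu A = \int[m]_(x in A) (p x)%:E.

Import HBNNSimple.

Let density_indic (A : set T) : measurable A ->
  \int[nu]_x (\1_A x)%:E = \int[m]_x ((\1_A x)%:E * (p x)%:E).
Proof.
move=> mA; rewrite integral_indic// setIT nuE// integral_mkcond.
apply: eq_integral => x _; rewrite patchE indicE.
by case: ifP => _; rewrite ?mul1e ?mul0e.
Qed.

Let density_nnsfun (f : {nnsfun T >-> R}) :
  \int[nu]_x (f x)%:E = \int[m]_x ((f x)%:E * (p x)%:E).
Proof.
have mpre r : measurable (f @^-1` [set r]).
  by rewrite -[X in measurable X]setTI; apply: (measurable_funP f).
have mind r : measurable_fun setT (fun x => (\1_(f @^-1` [set r]) x : R)).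
  exact: measurable_indic.
under eq_integral do rewrite fimfunE -fsumEFin//.
rewrite ge0_integral_fsum//; last 2 first.
- by move=> r; apply/measurable_EFinP; exact: measurable_funM.
- by move=> r x _; rewrite EFinM nnfun_muleindic_ge0.
under [RHS]eq_integral do rewrite fimfunE -EFinM mulr_fsuml// -fsumEFin//.
rewrite ge0_integral_fsum//; last 2 first.
- move=> r; apply/measurable_EFinP; apply: measurable_funM => //.
  exact: measurable_funM.
- move=> r x _; rewrite EFinM mule_ge0//; last by rewrite lee_fin.
  by rewrite EFinM nnfun_muleindic_ge0.
apply: eq_fsbigr => r; rewrite inE => -[x _ <-].
under eq_integral do rewrite EFinM.
under [RHS]eq_integral do rewrite !EFinM -muleA.
rewrite ge0_integralZl_EFin//; last exact/measurable_EFinP.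
rewrite ge0_integralZl_EFin//; first by rewrite density_indic.
- by move=> y _; rewrite mule_ge0// lee_fin.
- by apply: emeasurable_funM; exact/measurable_EFinP.
Qed.

Lemma integral_density (G : T -> \bar R) : measurable_fun setT G ->
  (forall x, 0 <= G x) -> \int[nu]_x G x = \int[m]_x (G x * (p x)%:E).
Proof.
move=> mG G0; pose G_ := nnsfun_approx measurableT mG.
have cvgG x : (G_ n x)%:E @[n --> \oo] --> G x by exact: cvg_nnsfun_approx.
have ndG x : {homo (fun n => (G_ n x)%:E) : n k / (n <= k)%N >-> n <= k}.
  by move=> n k nk; rewrite lee_fin; exact/lefP/nd_nnsfun_approx.
have mG_ n : measurable_fun setT (fun x => (G_ n x)%:E) by exact/measurable_EFinP.
transitivity (limn (fun n => \int[nu]_x (G_ n x)%:E)).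
  rewrite -monotone_convergence//.
  - by apply: eq_integral => x _; apply/esym/cvg_lim.
  - by move=> n x _; rewrite lee_fin.
under eq_fun do rewrite density_nnsfun.
rewrite -monotone_convergence//.
- apply: eq_integral => x _; apply/cvg_lim => //.
  have [->|px] := eqVneq (p x) 0%R.
    by rewrite mule0; under eq_fun do rewrite mule0; exact: cvg_cst.
  apply: cvgeM; [|exact: cvgG|exact: cvg_cst].
  by have := G0 x; case: (G x) => [r| |].
- by move=> n; apply: emeasurable_funM => //; exact/measurable_EFinP.
- by move=> n x _; rewrite mule_ge0// lee_fin.
- by move=> x _ n k nk; apply: lee_wpmul2r; [rewrite lee_fin|exact: ndG].
Qed.

End density.
(** * Gradient field on a finite lattice domain *)

Section finite_volume.
Context {R : realType} {d : nat}.
Local Notation Rm := (measurableTypeR R).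
Implicit Types (k : 'rV[int]_d).
Variables (V : R -> R) (c L beta : R) (D : set 'rV[R]_d) (eps : R).
Hypotheses (Veven : forall x, V (- x) = V x) (dV : forall x, derivable V x 1)
  (ddV : forall x, derivable V^`() x 1).
Hypotheses (c0 : 0 < c) (Vc : forall x, c <= V^`(2) x).
Hypotheses (L0 : 0 <= L) (VL : forall x y, `|derive1n 2 V x - derive1n 2 V y| <= L * `|x - y|).
Hypothesis V1 : V^`(2) 0 = 1.
Hypothesis beta0 : 0 < beta.

Let sb := Num.sqrt beta.

Let sb0 : 0 < sb. Proof. by rewrite sqrtr_gt0. Qed.
Let sb2 : sb * sb = beta. Proof. by rewrite -expr2 sqr_sqrtr// ltW. Qed.

Let h x := beta * V (x / sb).
Let h1 x := sb * derive1 V (x / sb).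
Let h2 x := derive1n 2 V (x / sb).

Let dscale (x : R) : is_derive x 1 (fun x => x / sb) sb^-1.
Proof.
have := is_derive_affine 0 sb^-1 x.
rewrite (_ : (fun s => 0 + s * sb^-1) = (fun x => x / sb))//.
by apply/funext => s; rewrite add0r.
Qed.

Let dh (x : R) : is_derive x 1 h (h1 x).
Proof.
have d1 : is_derive (x / sb) 1 V (derive1 V (x / sb)).
  by apply: DeriveDef; [exact: dV|rewrite derive1E].
have := is_deriveZ beta (@is_derive1_comp _ V (fun x => x / sb) x _ _ d1 (dscale x)).
rewrite (_ : beta *: _ = h1 x)// /GRing.scale/= /h1 -sb2.
by set v := derive1 V _; rewrite (mulrC v) mulrA mulfK// gt_eqF.
Qed.

Let dh1 (x : R) : is_derive x 1 h1 (h2 x).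
Proof.
have d1 : is_derive (x / sb) 1 (derive1 V) (derive1n 2 V (x / sb)).
  by apply: DeriveDef; [exact: ddV|rewrite -derive1E].
have := is_deriveZ sb (@is_derive1_comp _ (derive1 V) (fun x => x / sb) x _ _ d1 (dscale x)).
rewrite (_ : sb *: _ = h2 x)// /GRing.scale/= /h2.
by rewrite mulrCA divff ?mulr1// gt_eqF.
Qed.

Let h2l x : `|h2 x - 1| <= L / sb * `|x|.
Proof.
rewrite /h2 -V1; apply: le_trans (VL _ _) _.
by rewrite subr0 normrM normfV (gtr0_norm sb0) mulrA mulrAC.
Qed.

Let h_even x : h (- x) = h x. Proof. by rewrite /h mulNr Veven. Qed.

Lemma site_prekopa_leindler k : prekopa_leindler midpoint (site_measure D eps k).
Proof.
rewrite /site_measure; case: ifP => _.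
  exact: prekopa_leindler_dirac0.
exact: prekopa_leindler_lebesgue.
Qed.

(** On the boundary sites, which carry the Dirac mass at 0, a dilation is harmless
    but a translation must be trivial. *)
Lemma site_affine_bound k (a u kappa : R) : a != 0 -> `|a|^-1 <= kappa ->
  1 <= kappa -> (lattice_boundary D eps k -> u = 0) ->
  forall f : Rm -> \bar R, measurable_fun setT f -> (forall x, 0 <= f x)%E ->
  (\int[site_measure D eps k]_x f (affine a u x) <=
   kappa%:E * \int[site_measure D eps k]_x f x)%E.
Proof.
move=> a0 ak k1 ku f mf f0; rewrite /site_measure; case: ifP => [/asboolP bk|_].
  rewrite !integral_dirac//; last first.
    by apply: measurableT_comp mf _; exact: measurable_affine.
  rewrite !diracT !mul1e /affine ku// mulr0 addr0.
  by rewrite -[leLHS]mul1e; apply: lee_wpmul2r; [exact: f0|rewrite lee_fin].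
rewrite /affine ge0_integral_affine//; apply: lee_wpmul2r; last by rewrite lee_fin.
exact: integral_ge0.
Qed.

Let ref := @reference_measure R d D eps.

Let site (i : 'I_(size (sites D eps))) := tnth (in_tuple (sites D eps)) i.

Lemma reference_affine_bound (a kappa : R) (u : 'rV[int]_d -> R) : a != 0 ->
  `|a|^-1 <= kappa -> 1 <= kappa ->
  (forall k, lattice_boundary D eps k -> u k = 0) ->
  forall f : config D eps -> \bar R, measurable_fun setT f -> (forall x, 0 <= f x)%E ->
  (\int[ref]_x f (tuple_affine a (u \o site) x) <=
   (kappa ^+ size (sites D eps))%:E * \int[ref]_x f x)%E.
Proof.
move=> a0 ak k1 ku f mf f0; apply: affine_bound_product => //.
  exact: le_trans ler01 k1.
by move=> i g mg g0; apply: site_affine_bound => //; exact: ku.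
Qed.

Lemma height_affine (a : R) (u : 'rV[int]_d -> R) (x : config D eps) k :
  k \in sites D eps ->
  height (tuple_affine a (u \o site) x : config D eps) k = a * height x k + u k.
Proof.
move=> ks; have ki : (index k (sites D eps) < size (sites D eps))%N by rewrite index_mem.
rewrite /height -!(tnth_nth 0 _ (Ordinal ki)) tnth_mktuple /affine /=.
by congr (_ + u _); rewrite /site (tnth_nth k) /= nth_index.
Qed.

Lemma height_midpoint (x y : config D eps) k : k \in sites D eps ->
  height (tuple_midpoint x y : config D eps) k = (height x k + height y k) / 2.
Proof.
move=> ks; have ki : (index k (sites D eps) < size (sites D eps))%N by rewrite index_mem.
by rewrite /height -!(tnth_nth 0 _ (Ordinal ki)) tnth_mktuple.
Qed.

Lemma measurable_height k :
  measurable_fun setT (fun x : config D eps => height x k : R).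
Proof.
have [ki|ki] := ltnP (index k (sites D eps)) (size (sites D eps)).
  rewrite (_ : (fun x => _) = (fun x : config D eps => tnth x (Ordinal ki))).
    exact: measurable_tnth.
  by apply/funext => x; rewrite (tnth_nth 0).
rewrite (_ : (fun x => _) = cst 0); first exact: measurable_cst.
by apply/funext => x; rewrite /height nth_default// size_tuple.
Qed.

Lemma oriented_edge_sites b : b \in oriented_edges D eps ->
  b.1 \in sites D eps /\ b.2 \in sites D eps.
Proof.
rewrite mem_filter => /andP[_ /allpairsP[[k l] /= [ks ls ->]]] //.
Qed.

(* Edges are numbered so that the linearity of [A i] in the field holds for every
   index: both endpoints of [edge i] are sites. *)
Let edge (i : 'I_(size (oriented_edges D eps))) :=
  tnth (in_tuple (oriented_edges D eps)) i.

Let edgeP i : (edge i).1 \in sites D eps /\ (edge i).2 \in sites D eps.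
Proof. by apply: oriented_edge_sites; exact: mem_tnth. Qed.

Variables (dO : measure_display) (Omega : measurableType dO)
  (P : probability Omega R) (theta : {RV P >-> config D eps}).
Hypothesis theta_law : forall A : set (config D eps), measurable A ->
  distribution P theta A = gradient_field_law V beta A.

Variable phi : 'rV[R]_d -> R.
Hypothesis phi_boundary :
  forall k, lattice_boundary D eps k -> phi (site_point eps k) = 0.

Let A i (x : config D eps) : R := eta_tilde beta x (edge i).
Let a i : R := coefficient phi eps (edge i).
Let u (k : 'rV[int]_d) : R := eps `^ (d%:R / 2 - 1) * phi (site_point eps k) / sb.

Let sum_edges (f : 'rV[int]_d * 'rV[int]_d -> R) :
  \sum_(i <- index_enum 'I_(size (oriented_edges D eps))) f (edge i) =
  \sum_(b <- oriented_edges D eps) f b.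
Proof. by rewrite [RHS]big_tnth. Qed.

Let mA i : measurable_fun setT (A i).
Proof.
by apply: measurable_funM => //; apply: measurable_funB; exact: measurable_height.
Qed.

Let A_affine b (v : 'rV[int]_d -> R) i (x : config D eps) :
  A i (tuple_affine b (v \o site) x) =
  b * A i x + sb * (v (edge i).2 - v (edge i).1).
Proof.
by have [e1 e2] := edgeP i; rewrite /A /eta_tilde /Defs.eta !height_affine// -/sb; ring.
Qed.

Let A_mid i (x y : config D eps) : A i (tuple_midpoint x y) = (A i x + A i y) / 2.
Proof.
by have [e1 e2] := edgeP i; rewrite /A /eta_tilde /Defs.eta !height_midpoint// -/sb; ring.
Qed.

Let energyE (x : config D eps) :
  \sum_(i <- index_enum 'I_(size (oriented_edges D eps))) h (A i x) =
  beta * \sum_(b <- oriented_edges D eps) V (height x b.1 - height x b.2).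
Proof.
rewrite (sum_edges (fun b => h (eta_tilde beta x b))) mulr_sumr.
apply: eq_bigr => b _; rewrite /h /eta_tilde -/sb /Defs.eta mulrAC divff ?gt_eqF// mul1r.
by rewrite -Veven opprB.
Qed.

Let pairingE (x : config D eps) :
  \sum_(i <- index_enum 'I_(size (oriented_edges D eps))) a i * A i x =
  pairing beta phi x.
Proof.
rewrite (sum_edges (fun b => coefficient phi eps b * eta_tilde beta x b)).
by rewrite /pairing mulr_sumr; apply: eq_bigr => b _; rewrite /coefficient mulrA.
Qed.

Let Z := \int[ref]_x gibbs_weight V beta x.

Let mweight : measurable_fun setT (@gibbs_weight R d V beta D eps).
Proof.
rewrite (_ : @gibbs_weight R d V beta D eps =
   fun x => expR (- \sum_(i <- index_enum 'I_(size (oriented_edges D eps))) h (A i x))).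
  apply: measurableT_comp => //; apply: measurableT_comp => //.
  apply: measurable_sum => i; apply: measurableT_comp => //.
  apply: continuous_measurable_fun => x; apply: differentiable_continuous.
  by apply/derivable1_diffP; case: (dh x).
by apply/funext => x; rewrite energyE /gibbs_weight mulNr.
Qed.

(* A total mass 1 excludes both a zero and an infinite partition function: the real
   integral [Z] is 0 when the weight has infinite integral. *)
Let Zi0 : 0 < Z^-1.
Proof.
have Z0 : 0 <= Z by apply: Rintegral_ge0 => x _; exact: expR_ge0.
rewrite lt0r invr_ge0 Z0 andbT; apply/eqP => Zi.
have := theta_law measurableT.
rewrite /gradient_field_law -/ref -/Z Zi mul0e (@probability_setT _ _ _ (distribution P theta)).
by move=> /eqP; rewrite onee_eq0.
Qed.

Let law (G : config D eps -> \bar R) : measurable_fun setT G ->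
  (forall x, 0 <= G x)%E ->
  (\int[distribution P theta]_x G x = \int[ref]_x (G x * (Z^-1 * expR
    (- \sum_(i <- index_enum 'I_(size (oriented_edges D eps))) h (A i x)))%:E))%E.
Proof.
move=> mG G0.
rewrite (@integral_density _ _ _ ref _ (fun x => Z^-1 * gibbs_weight V beta x))//.
- by apply: eq_integral => x _; rewrite energyE /gibbs_weight mulNr.
- exact: measurable_funM.
- by move=> x; rewrite mulr_ge0 ?expR_ge0// ltW.
- move=> B mB; rewrite [LHS](theta_law mB) /gradient_field_law -/ref -/Z.
  rewrite -ge0_integralZl_EFin//.
  + by move=> x _; rewrite lee_fin expR_ge0.
  + by apply/measurable_EFinP; exact: measurable_funTS.
  + exact: ltW.
Qed.

Variable alpha : R.
Hypotheses (alpha0 : 0 <= alpha)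
  (coef_alpha : forall b, b \in oriented_edges D eps -> `|coefficient phi eps b| <= alpha)
  (al_small : alpha * L <= c / 8).

Let n := size (sites D eps).

Let half : config D eps -> config D eps := tuple_affine (1 / 2) ((fun=> 0) \o site).
Let neg : config D eps -> config D eps := tuple_affine (- 1) ((fun=> 0) \o site).
Let translate (s : R) : config D eps -> config D eps :=
  tuple_affine 1 ((fun k => s * u k) \o site).

Let u0 k : lattice_boundary D eps k -> u k = 0.
Proof. by move=> bk; rewrite /u phi_boundary// mulr0 mul0r. Qed.

Let half_bound (f : config D eps -> \bar R) : measurable_fun setT f ->
  (forall x, 0 <= f x)%E ->
  (\int[ref]_x f (half x) <= (2 ^+ n)%:E * \int[ref]_x f x)%E.
Proof.
move=> mf f0; apply: reference_affine_bound => //.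
  by rewrite gtr0_norm// mul1r invrK.
by rewrite ler1n.
Qed.

Let unit_bound (b : R) v (f : config D eps -> \bar R) : `|b| = 1 ->
  (forall k, lattice_boundary D eps k -> v k = 0) ->
  measurable_fun setT f -> (forall x, 0 <= f x)%E ->
  (\int[ref]_x f (tuple_affine b (v \o site) x) <= \int[ref]_x f x)%E.
Proof.
move=> b1 v0 mf f0; rewrite -[leRHS]mul1e -(expr1n _ n).
apply: reference_affine_bound => //; last by rewrite b1 invr1.
by rewrite -normr_eq0 b1 oner_eq0.
Qed.

Let neg_bound (f : config D eps -> \bar R) : measurable_fun setT f ->
  (forall x, 0 <= f x)%E -> (\int[ref]_x f (neg x) <= \int[ref]_x f x)%E.
Proof. by move=> mf f0; apply: unit_bound => //; rewrite normrN1. Qed.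

Let translate_bound s (f : config D eps -> \bar R) : measurable_fun setT f ->
  (forall x, 0 <= f x)%E -> (\int[ref]_x f (translate s x) <= \int[ref]_x f x)%E.
Proof.
move=> mf f0; apply: unit_bound => //; first by rewrite normr1.
by move=> k bk; rewrite u0// mulr0.
Qed.

Let A_half i x : A i (half x) = A i x / 2.
Proof. by rewrite A_affine subrr mulr0 addr0 mulrC mul1r. Qed.

Let A_neg i x : A i (neg x) = - A i x.
Proof. by rewrite A_affine subrr mulr0 addr0 mulN1r. Qed.

Let A_translate i s x : A i (translate s x) = A i x + s * a i.
Proof.
rewrite A_affine mul1r; congr (_ + _); rewrite /a /coefficient /u.
by field; rewrite gt_eqF.
Qed.

Let negK x : neg (neg x) = x.
Proof.
by apply: eq_from_tnth => i; rewrite !tnth_mktuple /affine/= !addr0 !mulN1r opprK.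
Qed.

Let translateK s x : translate s (translate (- s) x) = x.
Proof.
by apply: eq_from_tnth => i; rewrite !tnth_mktuple /affine/= !mul1r mulNr addrNK.
Qed.

Let a_alpha i : `|a i| <= alpha. Proof. by apply: coef_alpha; exact: mem_tnth. Qed.

Let PLref : prekopa_leindler (@tuple_midpoint R n) ref.
Proof. by apply: prekopa_leindler_product => i; exact: site_prekopa_leindler. Qed.

Let mpairing : measurable_fun setT (pairing beta phi : config D eps -> R).
Proof.
rewrite (_ : pairing _ _ = fun x : config D eps =>
    \sum_(i <- index_enum 'I_(size (oriented_edges D eps))) a i * A i x).
  by apply: measurable_sum => i; exact: measurable_funM.
by apply/funext => x; rewrite pairingE.
Qed.

Let integral_config (g : R -> R) : continuous g -> (forall x, `|g x| <= 1) ->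
  fine (\int[P]_w (g (pairing beta phi (theta w)))%:E) =
  \int[distribution P theta]_x g (pairing beta phi x).
Proof.
move=> cg g1; rewrite /Rintegral; congr fine.
have mg : measurable_fun setT (fun x : config D eps => g (pairing beta phi x)).
  by apply: (measurableT_comp (f := g)) => //; exact: continuous_measurable_fun.
rewrite integral_distribution//; first exact/measurable_EFinP.
apply: (le_integrable measurableT _ _ (finite_measure_integrable_cst P 1 measurableT)).
  by apply/measurable_EFinP; apply: (measurableT_comp mg).
by move=> w _; rewrite /= lee_fin normr1.
Qed.

(** The case [lam = sqrt beta] of the error bound, for which
    [lam * alpha * l = alpha * L]. *)
Lemma finite_volume_cf (t : R) :
  `|fine (\int[P]_w (cos (t * pairing beta phi (theta w)))%:E) -
    expR (- (t ^+ 2 / 2 * \sum_(b <- oriented_edges D eps) coefficient phi eps b ^+ 2))|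
  <= `|t| * ((1 + 2 * (alpha * L) ^+ 2 / c * (8 / (3 * c) * n%:R)) / sb).
Proof.
have al_l : sb * alpha * (L / sb) = alpha * L by field; rewrite gt_eqF.
have small : sb * alpha * (L / sb) <= c / 8 by rewrite al_l.
have ct : continuous (fun x : R => cos (t * x)).
  by move=> x; apply: continuous_comp; [exact: mulrl_continuous|exact: continuous_cos].
rewrite (@integral_config (fun x => cos (t * x)))//; last first.
  by move=> x; rewrite ler_norml cos_geN1 cos_le1.
have lsb : 0 <= L / sb by rewrite divr_ge0// ltW.
have := @cf_error R h h1 h2 c (L / sb) dh dh1 c0 (fun x => Vc _) lsb h2l h_even
  _ (config D eps) ref (distribution P theta) (@tuple_midpoint R n) half neg translate
  _ (index_enum 'I_(size (oriented_edges D eps))) A a alpha n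
  (measurable_tuple_affine _ _) (measurable_tuple_affine _ _)
  (fun s => measurable_tuple_affine _ _) PLref half_bound neg_bound translate_bound
  mA A_mid A_half A_neg negK A_translate translateK alpha0 a_alpha _ Zi0 law sb t sb0 small.
rewrite /anharmonic_error al_l.
rewrite (sum_edges (fun b => coefficient phi eps b ^+ 2)).
by under eq_Rintegral do rewrite pairingE.
Qed.

Lemma finite_volume_sin (t : R) :
  fine (\int[P]_w (sin (t * pairing beta phi (theta w)))%:E) = 0.
Proof.
have ct : continuous (fun x : R => sin (t * x)).
  by move=> x; apply: continuous_comp; [exact: mulrl_continuous|exact: continuous_sin].
rewrite (@integral_config (fun x => sin (t * x)))//; last first.
  by move=> x; rewrite ler_norml sin_geN1 sin_le1.
have := @integral_sin_eq0 R h h1 h2 c dh dh1 c0 (fun x => Vc _) h_even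
  _ (config D eps) ref (distribution P theta) half neg
  _ (index_enum 'I_(size (oriented_edges D eps))) A a n
  (measurable_tuple_affine _ _) (measurable_tuple_affine _ _)
  half_bound neg_bound mA A_half A_neg negK _ Zi0 law t.
by under eq_Rintegral do rewrite pairingE.
Qed.

End finite_volume.
(** * The scaling limit *)

Section limits.
Context {R : realType}.

Lemma cvg_real_complex (f : R -> R) (F : set_system R) (FF : Filter F) (l : R) :
  f x @[x --> F] --> l -> ((f x)%:C : R[i]^o) @[x --> F] --> (l%:C : R[i]^o).
Proof.
move=> fl; apply/cvgrPdist_le => -[e1 e2]; rewrite ltcE/= => /andP[/eqP-> e10].
have /cvgrPdist_le/(_ e1 e10) := fl; apply: filterS => x fx.
rewrite -rmorphB/= normc_def/= expr0n/= addr0 sqrtr_sqr lecE/= eqxx/=.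
exact: fx.
Qed.

Lemma lipschitz_bound (f : R -> R) : lipschitz f ->
  exists2 L : R, 0 <= L & forall x y, `|f x - f y| <= L * `|x - y|.
Proof.
move=> [M [_ HM]]; exists (Num.max M 0 + 1).
  by rewrite addr_ge0// le_max lexx orbT.
move=> x y; have := HM (Num.max M 0 + 1) _ (x, y).
by apply => //; rewrite ltr_pwDr// le_max lexx.
Qed.

(** A function that is not bounded below has infimum 0 by convention, so a positive
    infimum is a lower bound. *)
Lemma inf_range_le (f : R -> R) : 0 < inf (range f) -> forall x, inf (range f) <= f x.
Proof.
move=> f0 x; apply: ge_inf; last by exists x.
have [[]//|ninf] := pselect (has_inf (range f)).
by move: f0; rewrite inf_out// ltxx.
Qed.

End limits.

Theorem theorem4 (R : realType) (d : nat) (D : set 'rV[R]_d)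
    (V : R -> R) (beta : R -> R)
    (dO : R -> measure_display) (Omega : forall eps : R, measurableType (dO eps))
    (P : forall eps : R, probability (Omega eps) R)
    (theta : forall eps : R, {RV (P eps) >-> (config D eps)})
    (phi : 'rV[R]_d -> R) (t : R) :
  (2 <= d)%N ->
  bounded_smooth_domain D ->
  discretely_simply_connected D ->
  (forall x, V (- x) = V x) ->
  (forall x, derivable V x 1) ->
  (forall x, derivable V^`() x 1) ->
  lipschitz V^`(2) ->
  0 < inf (range V^`(2)) ->
  V^`(2) 0 = 1 ->
  (forall eps, 0 < eps -> 0 < beta eps) ->
  beta eps + (9 * d)%:R * ln eps @[eps --> 0^'+] --> +oo ->
  (forall eps, 0 < eps ->
     forall A : set (config D eps), measurable A ->
       distribution (P eps) (theta eps) A =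
       gradient_field_law V (beta eps) A) ->
  test_function D phi ->
  complex_expectation (P eps)
      (fun w => expi (t * pairing (beta eps) phi (theta eps w)))
    @[eps --> 0^'+] -->
  ((expR (- (t ^+ 2 / 2) * dirichlet_energy D phi))%:C : R[i]^o).
Proof.
move=> d2 [_ oD _ bD _] _ Veven dV ddV lipV infV V1 beta0 beta_lim law tphi.
pose c := inf (range V^`(2)).
have Vc x : c <= V^`(2) x by exact: inf_range_le.
have [L L0 VL] := lipschitz_bound lipV.
have [C C0 volC] := sites_volume bD.
have [B B0 coefB] := coefficient_bound tphi.
(* bounds [cutoff * E S] uniformly in [eps] *)
pose K : R := 16 * L ^+ 2 * B ^+ 2 * C / (3 * c ^+ 2).
have K0 : 0 <= K by rewrite divr_ge0// !mulr_ge0// ?sqr_ge0 ?ltW.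
pose f eps := fine (\int[P eps]_w (cos (t * pairing (beta eps) phi (theta eps w)))%:E)%E.
have f_lim : f eps @[eps --> 0^'+] --> expR (- (t ^+ 2 / 2) * dirichlet_energy D phi).
  have gauss_lim : expR (- (t ^+ 2 / 2) * \sum_(b <- oriented_edges D eps)
      coefficient phi eps b ^+ 2) @[eps --> 0^'+] -->
      expR (- (t ^+ 2 / 2) * dirichlet_energy D phi).
    apply: continuous_cvg; first exact: continuous_expR.
    by apply: cvgM; [exact: cvg_cst|exact: energy_convergence].
  apply/cvgrPdist_le => e e0.
  have e20 : 0 < e / 2 by rewrite divr_gt0.
  (* [sqrt beta >= s] makes the error at most [e / 2] *)
  pose s := 2 * (`|t| + 1) * (1 + K) / e.
  have t1 : 0 < `|t| + 1 by rewrite ltr_wpDl.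
  have K1 : 0 < 1 + K by rewrite ltr_pwDl.
  have s0 : 0 < s by rewrite divr_gt0// !mulr_gt0.
  (* [eps <= del] ensures [(w * B * L) ^ 2 <= eps * (B * L) ^ 2 <= (c / 8) ^ 2] *)
  pose del := (c / 8) ^+ 2 / ((B * L) ^+ 2 + 1).
  have del0 : 0 < del.
    by rewrite divr_gt0// ?exprn_gt0 ?divr_gt0// ltr_wpDl// sqr_ge0.
  near=> eps.
  have eps0 : 0 < eps by near: eps; exact: nbhs_right_gt.
  have eps1 : eps <= 1 by near: eps; exact: nbhs_right_le.
  have epsdel : eps <= del by near: eps; exact: nbhs_right_le.
  (* [ln eps <= 0], so the hypothesis on [beta] forces [beta] itself to infinity *)
  have sbeta : s <= Num.sqrt (beta eps).
    have : s ^+ 2 <= beta eps + (9 * d)%:R * ln eps.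
      by near: eps; move/cvgryPge : beta_lim; exact.
    move=> /le_trans/(_ (_ : _ <= beta eps)) sb.
    rewrite -(ger0_norm (ltW s0)) -sqrtr_sqr ler_wsqrtr// sb//.
    by rewrite gerDl mulr_ge0_le0// ln_le0.
  have gauss : `|expR (- (t ^+ 2 / 2) * dirichlet_energy D phi) -
      expR (- (t ^+ 2 / 2) * \sum_(b <- oriented_edges D eps) coefficient phi eps b ^+ 2)|
      <= e / 2.
    by near: eps; move/cvgrPdist_le : gauss_lim; exact.
  have bdry k : lattice_boundary D eps k -> phi (site_point eps k) = 0.
    by move: k; near: eps; exact: test_function_boundary.
  pose w := eps `^ (d%:R / 2 - 1) * eps.
  have w0 : 0 <= w by rewrite mulr_ge0 ?powR_ge0 ?ltW.
  have w2 : w ^+ 2 = eps ^+ d by exact: powR_scaling.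
  have al0 : 0 <= w * B by rewrite mulr_ge0 ?(ltW B0).
  have small : w * B * L <= c / 8.
    have c80 : 0 <= c / 8 by rewrite divr_ge0// ltW.
    rewrite -(@ler_pXn2r _ 2)// ?nnegrE; last exact: mulr_ge0 al0 L0.
    rewrite -mulrA exprMn w2; apply: (@le_trans _ _ (del * (B * L) ^+ 2)).
      apply: ler_wpM2r; first exact: sqr_ge0.
      apply: le_trans epsdel; rewrite -[leRHS]expr1.
      by apply: ler_wiXn2l; rewrite ?(ltW eps0)// (leq_trans _ d2).
    rewrite /del mulrAC ler_pdivrMr ?ltr_wpDl ?sqr_ge0//.
    by apply: ler_wpM2l; [exact: sqr_ge0|rewrite lerDl].
  have := finite_volume_cf Veven dV ddV infV Vc L0 VL V1 (beta0 _ eps0)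
    (law _ eps0) bdry al0 (coefB _ eps0) small t.
  rewrite -/(f eps) -mulNr => cf_err.
  have err : `|t| * ((1 + 2 * (w * B * L) ^+ 2 / c *
      (8 / (3 * c) * (size (sites D eps))%:R)) / Num.sqrt (beta eps)) <= e / 2.
    have -> : 2 * (w * B * L) ^+ 2 / c * (8 / (3 * c) * (size (sites D eps))%:R) =
      K / C * ((size (sites D eps))%:R * eps ^+ d).
      by rewrite -w2 /K; field; rewrite !gt_eqF.
    apply: (@le_trans _ _ (`|t| * ((1 + K) / s))).
      apply: ler_wpM2l => //; apply: ler_pM.
      - apply: addr_ge0 => //; apply: mulr_ge0; first by rewrite divr_ge0// ltW.
        by rewrite mulr_ge0// exprn_ge0// ltW.
      - by rewrite invr_ge0 sqrtr_ge0.
      - rewrite lerD2l -[leRHS](divfK (lt0r_neq0 C0)); apply: ler_wpM2l.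
          by rewrite divr_ge0// ltW.
        by apply: volC; rewrite eps0.
      - by rewrite lef_pV2// posrE// (lt_le_trans s0).
    rewrite /s invfM !mulrA.
    have -> : `|t| * (1 + K) / (2 * (`|t| + 1) * (1 + K)) / e^-1 =
      e / 2 * (`|t| / (`|t| + 1)).
      by field; rewrite !gt_eqF// ltr_wpDl.
    by rewrite ler_piMr ?(ltW e20)// ler_pdivrMr ?ltr_wpDl// mul1r lerDl.
  rewrite distrC in cf_err.
  set g := expR (- (t ^+ 2 / 2) * \sum_(b <- _) _) in gauss cf_err.
  rewrite (_ : _ - f eps =
    (expR (- (t ^+ 2 / 2) * dirichlet_energy D phi) - g) + (g - f eps)); last first.
    by rewrite addrA subrK.
  by apply: le_trans (ler_normD _ _) _; have := le_trans cf_err err => *; lra.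
apply: cvg_trans (cvg_real_complex _ f_lim).
apply: near_eq_cvg; near=> eps.
have eps0 : 0 < eps by near: eps; exact: nbhs_right_gt.
rewrite /complex_expectation unlock /= -/(f eps).
by rewrite (finite_volume_sin Veven dV ddV infV Vc (beta0 _ eps0) (law _ eps0)).
Unshelve. all: by end_near. Qed.
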